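(* Let $\pi=\mathcal{N}(m,\Sigma)$ on $\mathbb{R}^d$ with $m\in\mathbb{R}^d$ and $\Sigma\succ0$ with entries $\sigma_{ij}$, and let $\sigma^{ij}$ denote the $(i,j)$ entry of $\Sigma^{-1}$. Then $\min_{\mu\in\mathcal{C}_{\rm star}}\mathrm{KL}(\mu\|\pi)$ has a unique minimizer $\pi^\star(\mathrm{d}z)=\mathrm{p}^\star(\mathrm{d}z_1)\mathrm{q}^\star(\mathrm{d}z_{-1}\mid z_1)$ with $\mathrm{p}^\star=\mathcal{N}(m_1,\sigma_{11})$ and $\mathrm{q}^\star(\cdot\mid z_1)=\mathcal{N}(m^\star_{z_1},\Sigma^\star_{|1})$, where $m^\star_{z_1,i}=m_i+\sigma_{11}^{-1}\sigma_{1i}(z_1-m_1)$ for $i\ge2$ and $\Sigma^\star_{|1}=\mathrm{diag}((\sigma^{22})^{-1},\dots,(\sigma^{dd})^{-1})$. Equivalently $\pi^\star=\mathcal{N}(m,\Sigma^\star)$ with $\sigma^\star_{1i}=\sigma_{1i}$ for $i\in[d]$, $\sigma^\star_{ii}=(\sigma^{ii})^{-1}+\sigma_{1i}^2/\sigma_{11}$ for $i\ge2$, and $\sigma^\star_{ij}=\sigma_{1i}\sigma_{1j}/\sigma_{11}$ for $i\ne j$, $i,j\ge2$.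
   Context: $d\ge2$. $\mathcal{C}_{\rm star}$ is the set of probability measures $\mu$ on $\mathbb{R}^d$ of the form $\mu(\mathrm{d}z)=\mu_1(\mathrm{d}z_1)\prod_{j=2}^d\mu_j(\mathrm{d}z_j\mid z_1)$, i.e. $z_2,\dots,z_d$ conditionally independent given $z_1$; $z_{-1}=(z_2,\dots,z_d)$. KL is relative entropy. *)

(* Defs.v *)
From HB Require Import structures.
From mathcomp Require Import all_boot all_order all_algebra.
From mathcomp Require Import all_classical all_reals all_analysis.

Set Implicit Arguments.
Unset Strict Implicit.
Unset Printing Implicit Defensive.

Import Order.TTheory GRing.Theory Num.Theory.
Local Open Scope classical_set_scope.
Local Open Scope ring_scope.

(* R^d is modelled as d.-tuple R, equipped by MathComp-Analysis with the
   product (Borel) sigma-algebra generated by the coordinate maps tnth.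
   Coordinate z_1 of the paper is the coordinate ord0; the paper's
   coordinates 2..d are the coordinates (lift ord0 j), j : 'I_(d-1). *)

Section Defs.
Variable R : realType.

Definition rect_set (d : nat) (A : 'I_d -> set R) : set (d.-tuple R) :=
  [set z | forall i, A i (tnth z i)].

Definition lin_form (d : nat) (a : 'rV[R]_d) (z : d.-tuple R) : R :=
  \sum_(i < d) a 0 i * tnth z i.

Definition quad_form (d : nat) (a : 'rV[R]_d) (S : 'M[R]_d) : R :=
  (a *m S *m a^T) 0 0.

Definition posdef (d : nat) (S : 'M[R]_d) : Prop :=
  S^T = S /\ forall a : 'rV[R]_d, a != 0 -> 0 < quad_form a S.

(* mu = N(m, S) on R^d: every one-dimensional projection <a, z> has law
   N(<a, m>, a S a^T) (Dirac mass at <a, m> when the variance vanishes).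
   The library's [normal_prob mean s] is parameterised by the standard
   deviation s. *)
Definition is_gaussian (d : nat) (mu : probability (d.-tuple R) R)
    (m : 'rV[R]_d) (S : 'M[R]_d) : Prop :=
  forall (a : 'rV[R]_d) (B : set R), measurable B ->
    mu (lin_form a @^-1` B) =
      if quad_form a S == 0 then \d_(\sum_(i < d) a 0 i * m 0 i) B
      else normal_prob (\sum_(i < d) a 0 i * m 0 i) (Num.sqrt (quad_form a S)) B.

Definition KL (d : nat) (mu pi : probability (d.-tuple R) R) : \bar R :=
  if `[< charge_of_finite_measure mu `<< pi >] then
    (\int[mu]_x (ln (fine (Radon_Nikodym (charge_of_finite_measure mu) pi x)))%:E)%E
  else +oo%E.

(* The value on the rectangle A_1 x ... x A_d of the measure
   mu1(dz_1) prod_{j>=2} k_j(dz_j | z_1). *)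
Definition star_prod (n : nat) (mu1 : {measure set (measurableTypeR R) -> \bar R})
    (k : 'I_n -> R -> set R -> \bar R) (A : 'I_n.+1 -> set R) : \bar R :=
  (\int[mu1]_(x in A ord0) (\prod_(j < n) fine (k j x (A (lift ord0 j))))%:E)%E.

(* C_star : mu(dz) = mu_1(dz_1) prod_{j>=2} mu_j(dz_j | z_1), with
   mu_1 a probability on R and each mu_j(. | .) a probability kernel.
   Two probability measures on R^d agreeing on measurable rectangles
   coincide, so the identity is imposed on rectangles. *)
Definition C_star (n : nat) (mu : probability (n.+1.-tuple R) R) : Prop :=
  exists (mu1 : probability (measurableTypeR R) R)
         (k : 'I_n -> R.-pker (measurableTypeR R) ~> (measurableTypeR R)),
    forall A : 'I_n.+1 -> set R, (forall i, measurable (A i)) ->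
      mu (rect_set A) = star_prod mu1 (fun j x => k j x) A.

Definition Sigma_star (n : nat) (S : 'M[R]_n.+1) : 'M[R]_n.+1 :=
  \matrix_(i, j)
    if i == ord0 then S ord0 j
    else if j == ord0 then S ord0 i
    else if i == j then ((invmx S) i i)^-1 + (S ord0 i) ^+ 2 / S ord0 ord0
    else S ord0 i * S ord0 j / S ord0 ord0.

Definition mstar (n : nat) (m : 'rV[R]_n.+1) (S : 'M[R]_n.+1) (j : 'I_n) (z1 : R) : R :=
  m 0 (lift ord0 j) + (S ord0 ord0)^-1 * S ord0 (lift ord0 j) * (z1 - m 0 ord0).

End Defs.

(* Main.v *)
Require Import Defs.
From HB Require Import structures.
From mathcomp Require Import all_boot all_order all_algebra.
From mathcomp Require Import all_classical all_reals all_analysis.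
From mathcomp Require Import measurable_realfun ring lra.
Import Order.TTheory GRing.Theory Num.Theory.
Import numFieldNormedType.Exports.
Local Open Scope classical_set_scope.
Local Open Scope ring_scope.

Set Implicit Arguments.
Unset Strict Implicit.
Unset Printing Implicit Defensive.

(** Write Q for the inverse of S, Q' for its lower right block, and m_j(x) for
    the conditional mean of z_j given z_1 = x under pi.  For mu in C_star let
    u_j(x) be the mean of z_j - m_j(x) under mu_j(. | x), and let rho_u be the
    measure with first marginal p* and conditionals N(m_j(x) + u_j(x), 1/Q_jj).
    Then log (d rho_u / d pi) = K0 + (w^T Q' w - sum_j Q_jj (w_j - u_j)^2) / 2
    with w_j = z_j - m_j(z_1), and conditional independence turns its
    mu-expectation into K0 + E[u^T Q' u] / 2.  Gibbs' inequality therefore gives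
    KL(mu | pi) >= K0 + E[u^T Q' u] / 2 >= K0, with equality only if u = 0
    almost surely and mu = rho_0 = pi*; and KL(pi* | pi) = K0.

    The density of pi is not part of its definition by one-dimensional
    projections.  It is recovered by showing that the measure with density
    proportional to exp(- (z-m) Q (z-m)^T / 2) has Gaussian projections and that
    projections determine a measure.  For the projection on a, translating by
    a multiple of aS and completing the square shows that, after division by the
    Gaussian weight, the law of the projection is translation invariant, hence
    a multiple of Lebesgue measure. *)

(** * Product kernels *)

(** A law in [C_star] may be singular, and a quadratic need not be integrable under it, so entropies
    of its factors cannot simply be compared. Gibbs' inequality tests every [mu] against an explicit
    Gaussian density, but requires the quadratic log-ratio to be [mu]-integrable. This integrability
    is extracted from KL(mu | pi) < +oo, by the same inequality applied to truncated squares.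

    The shift u is chosen so that conditional variances drop out: w_j^2 - (w_j - u_j)^2 = 2 u_j w_j
    - u_j^2 has conditional mean u_j^2, and independence gives u_i u_j off the diagonal. Testing
    with u = 0 would leave only the terms Q_ij u_i u_j with i <> j, a form that in general has no
    fixed sign, and the bound K0 would be lost.

    Equality in Gibbs' inequality identifies densities only [mu]-almost everywhere. This yields mu
    <= pistar on measurable sets, and equal total masses do the rest. *)

Section KernelPrecomposition.
Context d d' d3 (X : measurableType d) (Y : measurableType d')
  (Z : measurableType d3) (R : realType) (f : X -> Y).

Hypothesis mf : measurable_fun setT f.

Definition kpre_fin (k : R.-fker Y ~> Z) (x : X) : {measure set Z -> \bar R} :=
  k (f x).

(** The measurability proof is an argument so that the kernel instances below, which depend on it,
    can be found from the term alone. *)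
Definition kpre of measurable_fun setT f := fun (k : R.-sfker Y ~> Z) (x : X) =>
  k (f x) : {measure set Z -> \bar R}.

Section Finite.
Variable k : R.-fker Y ~> Z.

Let mk U : measurable U -> measurable_fun setT (kpre_fin k ^~ U).
Proof. by move=> mU; exact: measurableT_comp (measurable_kernel k U mU) mf. Qed.

HB.instance Definition _ := isKernel.Build _ _ _ _ _ (kpre_fin k) mk.

Let uub : measure_fam_uub (kpre_fin k).
Proof. by have [r kr] := measure_uub k; exists r => x; exact: kr. Qed.

HB.instance Definition _ := Kernel_isFinite.Build _ _ _ _ _ (kpre_fin k) uub.

End Finite.

Section SFinite.
Variable k : R.-sfker Y ~> Z.

Let mk U : measurable U -> measurable_fun setT (kpre mf k ^~ U).
Proof. by move=> mU; exact: measurableT_comp (measurable_kernel k U mU) mf. Qed.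

HB.instance Definition _ := isKernel.Build _ _ _ _ _ (kpre mf k) mk.

Let sfin : exists s : (R.-fker X ~> Z)^nat,
  forall x U, measurable U -> kpre mf k x U = kseries s x U.
Proof.
have [s ks] := sfinite_kernel k.
exists (fun n => kpre_fin (s n)) => x U mU.
by rewrite /kpre ks.
Qed.

HB.instance Definition _ := Kernel_isSFinite.Build _ _ _ _ _ (kpre mf k) sfin.

End SFinite.

End KernelPrecomposition.

Lemma emeasurable_prod d (T : measurableType d) (R : realType) (I : Type)
    (s : seq I) (f : I -> T -> \bar R) :
  (forall i, measurable_fun setT (f i)) ->
  measurable_fun setT (fun t => \prod_(i <- s) f i t)%E.
Proof.
move=> mf; elim: s => [|i s IH].
  by under eq_fun do rewrite big_nil; exact: measurable_cst.
by under eq_fun do rewrite big_cons; exact: emeasurable_funM.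
Qed.

Section ProductKernel.
Context (R : realType).
Local Notation mR := (measurableTypeR R).

Lemma measurable_cons_tuple d (X : measurableType d) n :
  measurable_fun setT
    (fun p : (X * mR) * n.-tuple R => [the n.+1.-tuple R of p.1.2 :: p.2]).
Proof.
apply: measurable_cons; last exact: measurable_snd.
have : measurable_fun setT (fun p : (X * mR) * n.-tuple R => p.1.2 : mR).
  by apply: (measurableT_comp (f := snd)).
exact.
Qed.

(** Independent draws given [x]: draw the head, then the tail, then glue them by a Dirac kernel.
    Precomposing the tail kernel with [fst] hides the drawn head from it, which is the
    independence. *)
Fixpoint prodk d (X : measurableType d) n {struct n} :
    ('I_n -> R.-sfker X ~> mR) -> R.-sfker X ~> n.-tuple R :=
  match n with
  | 0 => fun _ => kdirac (@measurable_cst _ _ X (0.-tuple R) setT [tuple])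
  | n'.+1 => fun k =>
      mkcomp (k ord0)
        (mkcomp (kpre (@measurable_fst _ _ X mR)
                  (@prodk d X n' (fun j => k (lift ord0 j))))
                (kdirac (@measurable_cons_tuple d X n'))
          : R.-sfker (X * mR) ~> n'.+1.-tuple R)
  end.

Lemma integral_prodk0 d (X : measurableType d) (k : 'I_0 -> R.-sfker X ~> mR) x
    (F : 0.-tuple R -> \bar R) : (forall t, 0 <= F t)%E -> measurable_fun setT F ->
  (\int[prodk k x]_t F t = F [tuple])%E.
Proof. by move=> F0 mF; rewrite integral_dirac// diracT mul1e. Qed.

Lemma integral_prodkS d (X : measurableType d) n
    (k : 'I_n.+1 -> R.-sfker X ~> mR) x
    (F : n.+1.-tuple R -> \bar R) : (forall t, 0 <= F t)%E ->
  measurable_fun setT F ->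
  (\int[prodk k x]_t F t =
   \int[k ord0 x]_y \int[prodk (fun j => k (lift ord0 j)) x]_t
     F [the n.+1.-tuple R of y :: t])%E.
Proof.
move=> F0 mF; rewrite [LHS]integral_kcomp//.
apply: eq_integral => y _.
rewrite integral_kcomp//; apply: eq_integral => t _.
by rewrite integral_dirac// diracT mul1e.
Qed.

Lemma integral_prodk_prod d (X : measurableType d) n
    (k : 'I_n -> R.-sfker X ~> mR) x (f : 'I_n -> mR -> \bar R) :
  (forall j y, 0 <= f j y)%E -> (forall j, measurable_fun setT (f j)) ->
  (\int[prodk k x]_t \prod_(j < n) f j (tnth t j) =
   \prod_(j < n) \int[k j x]_y f j y)%E.
Proof.
have mt m (g : 'I_m -> mR -> \bar R) : (forall j, measurable_fun setT (g j)) ->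
    measurable_fun setT (fun t : m.-tuple R => \prod_(j < m) g j (tnth t j))%E.
  move=> mg; apply: emeasurable_prod => j.
  exact: (measurableT_comp (mg j) (measurable_tnth (T := R) j)).
elim: n k f => [|n IH] k f f0 mf.
  rewrite integral_prodk0.
  - by rewrite !big_ord0.
  - by move=> t; apply: prode_ge0.
  - exact: mt.
rewrite integral_prodkS; last 2 first.
- by move=> t; apply: prode_ge0.
- exact: mt.
transitivity (\int[k ord0 x]_y (f ord0 y *
    \prod_(j < n) \int[k (lift ord0 j) x]_z f (lift ord0 j) z))%E.
  apply: eq_integral => y _.
  rewrite -IH// -ge0_integralZl//; last 2 first.
  - exact: (mt _ (fun j => f (lift ord0 j))).
  - by move=> t _; apply: prode_ge0.
  apply: eq_integral => t _; rewrite big_ord_recl; congr (_ * _)%E.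
  by apply: eq_bigr => j _; rewrite tnthS.
rewrite big_ord_recl ge0_integralZr//.
by apply: prode_ge0 => j _; apply: integral_ge0.
Qed.

End ProductKernel.

Section ConstantKernel.
Context d d' (X : measurableType d) (Y : measurableType d') (R : realType).

Definition kconst_fin (m : {finite_measure set Y -> \bar R}) (x : X) :
  {measure set Y -> \bar R} := m.

(** Constant kernels let a measure, such as Lebesgue measure or a marginal law, enter kernel
    compositions. *)
Definition kconst (m : {sfinite_measure set Y -> \bar R}) (x : X) :
  {measure set Y -> \bar R} := m.

Section Finite.
Variable m : {finite_measure set Y -> \bar R}.

Let mk U : measurable U -> measurable_fun setT (kconst_fin m ^~ U).
Proof. by move=> mU; exact: measurable_cst. Qed.

HB.instance Definition _ := isKernel.Build _ _ _ _ _ (kconst_fin m) mk.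

Let uub : measure_fam_uub (kconst_fin m).
Proof.
exists (fine (m setT) + 1) => x.
by rewrite /kconst_fin EFinD fineK ?fin_num_measure// lteDl ?fin_num_measure// lte01.
Qed.

HB.instance Definition _ := Kernel_isFinite.Build _ _ _ _ _ (kconst_fin m) uub.

End Finite.

Section SFinite.
Variable m : {sfinite_measure set Y -> \bar R}.

Let mk U : measurable U -> measurable_fun setT (kconst m ^~ U).
Proof. by move=> mU; exact: measurable_cst. Qed.

HB.instance Definition _ := isKernel.Build _ _ _ _ _ (kconst m) mk.

Let sfin : exists s : (R.-fker X ~> Y)^nat,
  forall x U, measurable U -> kconst m x U = kseries s x U.
Proof.
exists (fun n => kconst_fin (sfinite_measure_seq m n)) => x U mU.
exact: sfinite_measure_seqP.
Qed.

HB.instance Definition _ := Kernel_isSFinite.Build _ _ _ _ _ (kconst m) sfin.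

End SFinite.

End ConstantKernel.

(** * Lebesgue measure on tuples and its translation invariance *)

Section LebesgueTuple.
Context (R : realType).
Local Notation mR := (measurableTypeR R).

(** The translated measure agrees with Lebesgue measure on half-open intervals, which determine it;
    integrals follow by pushforward. *)
Lemma ge0_integral_lebesgue_shift (c : R) (f : mR -> \bar R) :
  (forall x, 0 <= f x)%E -> measurable_fun setT f ->
  (\int[lebesgue_measure]_x f (x + c)%R = \int[lebesgue_measure]_x f x)%E.
Proof.
move=> f0 mf.
have ms : measurable_fun [set: mR] (fun x : mR => (x + c)%R : mR).
  have := measurable_funD (@measurable_id _ R setT) (@measurable_cst _ _ R R setT c).
  exact.
have := @ge0_integral_pushforward _ _ _ _ R _ ms lebesgue_measure setT f
  measurableT mf (fun y _ => f0 y).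
rewrite preimage_setT => <-; apply/esym/eq_measure_integral => A mA _.
have := @lebesgue_measure_unique R
  (pushforward (lebesgue_measure : set mR -> \bar R) (fun x : mR => (x + c)%R : mR)).
apply => // _ [[a b] _ <-] /=.
rewrite /pushforward.
have -> : ((fun x : R => (x + c)%R) @^-1` `]a, b] = `](a - c)%R, (b - c)%R])%classic.
  apply/seteqP; split => x /=; rewrite !in_itv/= => /andP[h1 h2]; apply/andP; lra.
rewrite !lebesgue_measure_itv/= !lte_fin ltrD2r.
by case: ifP => // _; rewrite -!EFinB; congr EFin; ring.
Qed.

Definition lebk d (X : measurableType d) : R.-sfker X ~> mR :=
  @kconst _ _ X mR R (lebesgue_measure : {sfinite_measure set mR -> \bar R}).

(** As a product of constant kernels over a one-point source, it comes with Tonelli's formula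
    coordinate by coordinate. *)
Definition lebn n : {measure set (n.-tuple R) -> \bar R} :=
  prodk (fun _ : 'I_n => lebk unit) tt.

Lemma integral_lebnS n (F : n.+1.-tuple R -> \bar R) : (forall t, 0 <= F t)%E ->
  measurable_fun setT F ->
  (\int[lebn n.+1]_t F t =
   \int[lebesgue_measure]_y \int[lebn n]_t F [the n.+1.-tuple R of y :: t])%E.
Proof. by move=> F0 mF; rewrite [LHS]integral_prodkS. Qed.

Lemma integral_lebn_prod n (f : 'I_n -> mR -> \bar R) :
  (forall j y, 0 <= f j y)%E -> (forall j, measurable_fun setT (f j)) ->
  (\int[lebn n]_t \prod_(j < n) f j (tnth t j) =
   \prod_(j < n) \int[lebesgue_measure]_y f j y)%E.
Proof. by move=> f0 mf; rewrite [LHS]integral_prodk_prod. Qed.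

Lemma measurable_pair_cons n :
  measurable_fun setT (fun p : mR * n.-tuple R => [the n.+1.-tuple R of p.1 :: p.2]).
Proof.
apply: measurable_cons; last exact: measurable_snd.
exact: (@measurable_fst _ _ mR (n.-tuple R)).
Qed.

Lemma measurable_cons_cst n (y : R) :
  measurable_fun setT (fun t : n.-tuple R => [the n.+1.-tuple R of y :: t]).
Proof. by apply: measurable_cons => //; exact: measurable_cst. Qed.

Lemma measurable_integral_prodk d (X : measurableType d) n
    (k : 'I_n -> R.-sfker X ~> mR) (F : X * n.-tuple R -> \bar R) :
  (forall t, 0 <= F t)%E -> measurable_fun setT F ->
  measurable_fun setT (fun x => \int[prodk k x]_t F (x, t))%E.
Proof. by move=> F0 mF; exact: measurable_fun_integral_sfinite_kernel. Qed.

Lemma measurable_integral_lebn d (X : measurableType d) n (F : X * n.-tuple R -> \bar R) :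
  (forall t, 0 <= F t)%E -> measurable_fun setT F ->
  measurable_fun setT (fun x => \int[lebn n]_t F (x, t))%E.
Proof.
move=> F0 mF.
(* Precomposing with the constant map to the point turns [lebn] into a kernel with source [X]. *)
exact: (@measurable_fun_integral_sfinite_kernel _ _ _ _ _ F
  (kpre (@measurable_cst _ _ X unit setT tt) (prodk (fun _ : 'I_n => lebk unit)))).
Qed.

Definition shift_tuple n (h : 'I_n -> R) (t : n.-tuple R) : n.-tuple R :=
  [tuple tnth t i + h i | i < n].

Lemma measurable_shift_tuple n (h : 'I_n -> R) : measurable_fun setT (shift_tuple h).
Proof.
apply/measurable_fun_tnthP => i.
rewrite (_ : _ \o _ = fun t => tnth t i + h i).
  by apply: measurable_funD => //; exact: measurable_tnth.
by apply/funext => t /=; rewrite tnth_mktuple.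
Qed.

(** Tonelli reduces this to one dimension: the head is moved by the Lebesgue case, the tail by
    induction. *)
Lemma ge0_integral_lebn_shift n (h : 'I_n -> R) (F : n.-tuple R -> \bar R) :
  (forall t, 0 <= F t)%E -> measurable_fun setT F ->
  (\int[lebn n]_t F (shift_tuple h t) = \int[lebn n]_t F t)%E.
Proof.
elim: n h F => [|n IH] h F F0 mF.
  by apply: eq_integral => t _; rewrite [shift_tuple h t]tuple0 [t in RHS]tuple0.
rewrite integral_lebnS//; last first.
  exact: (measurableT_comp mF (measurable_shift_tuple h)).
rewrite integral_lebnS//.
rewrite -[RHS](ge0_integral_lebesgue_shift (h ord0)); last 2 first.
- by move=> x; exact: integral_ge0.
- apply: (measurable_integral_lebn
    (F := fun p : mR * n.-tuple R => F [the n.+1.-tuple R of p.1 :: p.2])) => //.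
  exact: (measurableT_comp mF (@measurable_pair_cons n)).
apply: eq_integral => y _.
rewrite -[RHS](IH (fun j => h (lift ord0 j)))//; last first.
  exact: (measurableT_comp mF (@measurable_cons_cst n _)).

apply: eq_integral => t _; congr (F _).
apply: eq_from_tnth => i; rewrite tnth_mktuple.
case: (unliftP ord0 i) => [j ->|->]; last by [].
by rewrite !tnthS tnth_mktuple.
Qed.

End LebesgueTuple.

(** * Measures with a density *)

Section Density.
Context d (T : measurableType d) (R : realType).
Local Open Scope ereal_scope.
Variables (m P : {measure set T -> \bar R}) (g : T -> R).
Hypotheses (mg : measurable_fun setT g) (g0 : forall x, (0 <= g x)%R).
Hypothesis Pg : forall A, measurable A -> P A = \int[m]_(x in A) (g x)%:E.

Import HBNNSimple.

(** Holds for indicators by [Pg], for simple functions by linearity, and in general by monotone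
    convergence on both sides. *)
Lemma ge0_integral_density (f : T -> \bar R) : (forall x, 0 <= f x) ->
  measurable_fun setT f -> \int[P]_x f x = \int[m]_x (f x * (g x)%:E).
Proof.
move=> f0 mf.
have mge : measurable_fun setT (EFin \o g) by exact/measurable_EFinP.
have ge0 x : 0 <= (EFin \o g) x by rewrite lee_fin.
pose h := nnsfun_approx measurableT mf.
have -> : \int[P]_x f x = lim (\int[P]_x (EFin \o h n) x @[n --> \oo]).
  have fE x : f x = lim ((EFin \o h n) x @[n --> \oo]).
    by apply/esym/cvg_lim => //; exact: cvg_nnsfun_approx.
  under eq_integral do rewrite fE.
  apply: monotone_convergence => //.
  - by move=> n; exact/measurable_EFinP.
  - by move=> n x _ /=; rewrite lee_fin.
  - by move=> x _ a b ab; rewrite lee_fin; exact/lefP/nd_nnsfun_approx.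
have -> : \int[m]_x (f x * (g x)%:E) =
    lim (\int[m]_x ((EFin \o h n) x * (EFin \o g) x) @[n --> \oo]).
  have fg x : f x * (g x)%:E = lim (((EFin \o h n) x * (EFin \o g) x) @[n --> \oo]).
    by apply/esym/cvg_lim => //; apply: cvgeZr => //; exact: cvg_nnsfun_approx.
  under eq_integral do rewrite fg.
  apply: monotone_convergence => //.
  - by move=> n; apply: emeasurable_funM => //; exact/measurable_EFinP.
  - by move=> n x _; rewrite mule_ge0 ?lee_fin.
  - by move=> x _ a b ab; rewrite lee_wpmul2r ?lee_fin//; exact/lefP/nd_nnsfun_approx.
congr (lim _); apply: congr2 => //; apply/funext => n.
under eq_integral do rewrite /= fimfunE -fsumEFin//.
rewrite ge0_integral_fsum//; last 2 first.
- by move=> r; exact/measurable_EFinP/measurableT_comp.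
- by move=> r x _; rewrite EFinM nnfun_muleindic_ge0.
transitivity (\int[m]_x (\sum_(y \in range (h n))
    ((y * \1_(h n @^-1` [set y]) x)%:E * (g x)%:E))); last first.
  apply: eq_integral => x _.
  rewrite -ge0_mule_fsuml => [|y]; last by rewrite EFinM nnfun_muleindic_ge0.
  by rewrite fsumEFin // -(fimfunE _ x).
rewrite ge0_integral_fsum//; last 2 first.
- move=> y; apply: emeasurable_funM => //.
  by apply/measurable_EFinP; exact: measurable_funM.
- by move=> y x _; apply: mule_ge0; [rewrite EFinM nnfun_muleindic_ge0|rewrite lee_fin].
apply: eq_fsbigr => r /set_mem[t _ rE].
have r0 : (0 <= r)%R by rewrite -rE.
under eq_integral do rewrite EFinM.
rewrite ge0_integralZl//; last exact/measurable_EFinP.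
under [RHS]eq_integral do rewrite EFinM -muleA.
rewrite ge0_integralZl//; last 2 first.
- by apply: emeasurable_funM => //; exact/measurable_EFinP.
- by move=> x _; rewrite mule_ge0 ?lee_fin.
congr (_ * _); rewrite integral_indic// setIT Pg// integral_mkcond.
by apply: eq_integral => x _; rewrite epatch_indic muleC.
Qed.

End Density.

Lemma density_probability d (T : measurableType d) (R : realType)
    (m : {measure set T -> \bar R}) (g : T -> R) :
  measurable_fun setT g -> (forall x, 0 <= g x) ->
  (\int[m]_x (g x)%:E = 1)%E ->
  exists P : probability T R, forall A, P A = (\int[m]_(x in A) (g x)%:E)%E.
Proof.
move=> mg g0 g1.
pose nu (A : set T) : \bar R := (\int[m]_(x in A) (g x)%:E)%E.
have nu0 : nu set0 = 0%E by rewrite /nu integral_set0.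
have nuge0 A : (0 <= nu A)%E by apply: integral_ge0 => x _; rewrite lee_fin.
have nusa : semi_sigma_additive nu.
  apply: semi_sigma_additive_nng_induced; first exact/measurable_EFinP.
  by move=> x; rewrite lee_fin.
pose b1 := isMeasure.Build _ _ _ nu nu0 nuge0 nusa.
pose M : measure T R := HB.pack nu b1.
have MT : M setT = 1%E := g1.
pose b2 := Measure_isProbability.Build _ _ _ M MT.
pose P : probability T R := HB.pack nu b1 b2.
by exists P.
Qed.

(** * Uniqueness of measures from one-dimensional projections *)

Section ExpectationDeterminingClass.
Context d (T : measurableType d) (R : realType) (P Q : probability T R).
Implicit Types (f g h : T -> R).

Definition bounded_mfun f :=
  measurable_fun setT f /\ exists M, forall x, `|f x| <= M.

Definition same_expectation f :=
  bounded_mfun f /\ (\int[P]_x (f x)%:E = \int[Q]_x (f x)%:E)%E.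

Lemma bounded_mfun_integrable (m : probability T R) f :
  bounded_mfun f -> m.-integrable setT (EFin \o f).
Proof.
move=> [mf [M fM]]; apply: measurable_bounded_integrable => //.
  by rewrite (le_lt_trans (probability_le1 _ _))// ltry.
by exists M; split; [exact: num_real|move=> x Mx t _ /=; exact: le_trans (fM t) (ltW Mx)].
Qed.

Lemma bounded_mfunD f g : bounded_mfun f -> bounded_mfun g ->
  bounded_mfun (fun x => f x + g x).
Proof.
move=> [mf [M fM]] [mg [N gN]]; split; first exact: measurable_funD.
by exists (M + N) => x; rewrite (le_trans (ler_normD _ _))// lerD.
Qed.

Lemma bounded_mfunM f g : bounded_mfun f -> bounded_mfun g ->
  bounded_mfun (fun x => f x * g x).
Proof.
move=> [mf [M fM]] [mg [N gN]]; split; first exact: measurable_funM.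
by exists (M * N) => x; rewrite normrM ler_pM.
Qed.

Lemma bounded_mfun_cst (c : R) : bounded_mfun (fun=> c).
Proof. by split => //; exists `|c|. Qed.

Lemma same_expectationD f g : same_expectation f -> same_expectation g ->
  same_expectation (fun x => f x + g x).
Proof.
move=> [bf Ef] [bg Eg]; split; first exact: bounded_mfunD.
have E (m : probability T R) :
    (\int[m]_x (f x + g x)%:E = \int[m]_x (f x)%:E + \int[m]_x (g x)%:E)%E.
  by under eq_integral do rewrite EFinD; rewrite integralD//; exact: bounded_mfun_integrable.
by rewrite !E Ef Eg.
Qed.

Lemma same_expectationZ c f : same_expectation f ->
  same_expectation (fun x => c * f x).
Proof.
move=> [bf Ef]; split; first by apply: bounded_mfunM => //; exact: bounded_mfun_cst.
have E (m : probability T R) : (\int[m]_x (c * f x)%:E = c%:E * \int[m]_x (f x)%:E)%E.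
  by under eq_integral do rewrite EFinM; rewrite integralZl//; exact: bounded_mfun_integrable.
by rewrite !E Ef.
Qed.

Lemma same_expectation_cvg (f_ : nat -> T -> R) f M :
  (forall n, same_expectation (f_ n)) -> (forall n x, `|f_ n x| <= M) ->
  (forall x, f_ ^~ x @ \oo --> f x) -> same_expectation f.
Proof.
move=> sf fM cf.
have mf : measurable_fun setT f.
  apply: (measurable_fun_cvg (h := f_)) => //.
  by move=> n; case: (sf n) => -[].
have bf : bounded_mfun f.
  split => //; exists M => x.
  apply: (ler_cvg_to (cvg_norm (cf x)) (cvg_cst M)).
  by near=> n; exact: fM.
split => //.
have E (m : probability T R) : (\int[m]_x (f_ n x)%:E @[n --> \oo] --> \int[m]_x (f x)%:E)%E.
  have := @dominated_convergence _ _ _ m _ measurableT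
    (fun n => EFin \o f_ n) (EFin \o f) (EFin \o cst M).
  case => //.
  - by move=> n; apply/measurable_EFinP; case: (sf n) => -[].
  - exact/measurable_EFinP.
  - by apply: aeW => x _; apply: cvg_EFin; [exact: nearW|exact: cf].
  - by apply: bounded_mfun_integrable; exact: bounded_mfun_cst.
  - by apply: aeW => x n _; rewrite lee_fin.
have EP := E P; have EQ := E Q.
apply: (cvg_unique _ EP); first exact: ereal_hausdorff.
rewrite (_ : (fun n => _) = (fun n => \int[Q]_x (f_ n x)%:E)%E)//.
by apply/funext => n; case: (sf n).
Unshelve. all: by end_near. Qed.

Variable G : set (T -> R).
Hypothesis G1 : G (fun=> 1).
Hypothesis GE : forall g, G g -> same_expectation g.
(** The shape of the product-to-sum formula for cosines: the linear span of [G] is closed under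
    products. *)
Hypothesis GM : forall g g', G g -> G g' -> exists h h',
  [/\ G h, G h' & forall x, g x * g' x = 2^-1 * h x + 2^-1 * h' x].

(* The multipliers of the functions whose expectation against every element of
   [G] agrees form an algebra containing [G]; multiplying twice is what makes
   the class stable under products. *)
Definition determined_against f :=
  bounded_mfun f /\ forall g, G g -> same_expectation (fun x => f x * g x).

Definition multiplier f := bounded_mfun f /\
  forall h, determined_against h -> determined_against (fun x => f x * h x).

Lemma determined_againstD f g : determined_against f -> determined_against g ->
  determined_against (fun x => f x + g x).
Proof.
move=> [bf Hf] [bg Hg]; split; first exact: bounded_mfunD.
move=> k Gk; have := same_expectationD (Hf _ Gk) (Hg _ Gk).
by under eq_fun do rewrite -mulrDl.
Qed.

Lemma determined_againstZ c f : determined_against f ->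
  determined_against (fun x => c * f x).
Proof.
move=> [bf Hf]; split; first by apply: bounded_mfunM => //; exact: bounded_mfun_cst.
move=> k Gk; have := same_expectationZ c (Hf _ Gk).
by under eq_fun do rewrite mulrA.
Qed.

Lemma determined_against_cvg (f_ : nat -> T -> R) f M :
  (forall n, determined_against (f_ n)) -> (forall n x, `|f_ n x| <= M) ->
  (forall x, f_ ^~ x @ \oo --> f x) -> determined_against f.
Proof.
move=> Hf fM cf.
have E g : G g -> same_expectation (fun x => f x * g x).
  move=> Gg; have [[mg [N gN]] _] := GE Gg.
  apply: (same_expectation_cvg (f_ := fun n x => f_ n x * g x) (M := M * N)).
  - by move=> n; exact: (Hf n).2.
  - by move=> n x; rewrite normrM ler_pM.
  - by move=> x; apply: cvgM; [exact: cf|exact: cvg_cst].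
split => //; have [+ _] := E _ G1.
by under eq_fun do rewrite mulr1.
Qed.

Lemma determined_against1 : determined_against (fun=> 1).
Proof.
split; first exact: bounded_mfun_cst.
by move=> g Gg; under eq_fun do rewrite mul1r; exact: GE.
Qed.

(** Since (g h) g' = h (g g') and g g' is an average of two elements of [G], testing g h against g'
    reduces to testing h against [G]. *)
Lemma multiplier_G g : G g -> multiplier g.
Proof.
move=> Gg; have [bg _] := GE Gg; split => // h [bh Hh].
split; first exact: bounded_mfunM.
move=> g' Gg'; have [k [k' [Gk Gk' gE]]] := GM Gg Gg'.
have := same_expectationD (same_expectationZ 2^-1 (Hh _ Gk))
  (same_expectationZ 2^-1 (Hh _ Gk')).
congr same_expectation; apply/funext => x.
by rewrite mulrAC gE; ring.
Qed.

Lemma multiplier_cst c : multiplier (fun=> c).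
Proof.
by split; [exact: bounded_mfun_cst|move=> h; exact: determined_againstZ].
Qed.

Lemma multiplierD f g : multiplier f -> multiplier g ->
  multiplier (fun x => f x + g x).
Proof.
move=> [bf Hf] [bg Hg]; split; first exact: bounded_mfunD.
move=> h Hh; have := determined_againstD (Hf _ Hh) (Hg _ Hh).
by under eq_fun do rewrite -mulrDl.
Qed.

Lemma multiplierM f g : multiplier f -> multiplier g ->
  multiplier (fun x => f x * g x).
Proof.
move=> [bf Hf] [bg Hg]; split; first exact: bounded_mfunM.
by move=> h Hh; have := Hf _ (Hg _ Hh); under eq_fun do rewrite mulrA.
Qed.

Lemma multiplier_cvg (f_ : nat -> T -> R) f M :
  (forall n, multiplier (f_ n)) -> (forall n x, `|f_ n x| <= M) ->
  (forall x, f_ ^~ x @ \oo --> f x) -> multiplier f.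
Proof.
move=> Hf fM cf.
have E h : determined_against h -> determined_against (fun x => f x * h x).
  move=> Hh; have [[mh [N hN]] _] := Hh.
  apply: (determined_against_cvg (f_ := fun n x => f_ n x * h x) (M := M * N)).
  - by move=> n; exact: (Hf n).2.
  - by move=> n x; rewrite normrM ler_pM.
  - by move=> x; apply: cvgM; [exact: cf|exact: cvg_cst].
split => //; have [+ _] := E _ determined_against1.
by under eq_fun do rewrite mulr1.
Qed.

Lemma multiplier_same f : multiplier f -> same_expectation f.
Proof.
move=> [_ Hf]; have [_ /(_ _ G1)] := Hf _ determined_against1.
by under eq_fun do rewrite !mulr1.
Qed.

(** Multipliers form an algebra containing the constants and closed under bounded pointwise limits:
    complements come from 1 - x, binary unions from x + y - x y, countable unions as limits of
    finite ones. *)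
Lemma sigma_algebra_multiplier : sigma_algebra setT [set A | multiplier (\1_A : T -> R)].
Proof.
split => /=.
- rewrite indic0; exact: multiplier_cst.
- move=> A HA; rewrite setTD.
  have -> : (\1_(~` A) : T -> R) = (fun x => 1 + -1 * \1_A x).
    by apply/funext => x; rewrite !indicE in_setC; case: (x \in A) => /=; ring.
  by apply: multiplierD; [exact: multiplier_cst|apply: multiplierM => //; exact: multiplier_cst].
- move=> A HA.
  pose B n := \big[setU/set0]_(i < n) A i.
  have HB n : multiplier (\1_(B n) : T -> R).
    rewrite /B; elim: n => [|n IH].
      by rewrite big_ord0 indic0; exact: multiplier_cst.
    rewrite big_ord_recr/=.
    have -> : (\1_(\big[setU/set0]_(i < n) A i `|` A n) : T -> R) =
        (fun x => \1_(\big[setU/set0]_(i < n) A i) x + \1_(A n) x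
          + -1 * (\1_(\big[setU/set0]_(i < n) A i) x * \1_(A n) x)).
      apply/funext => x; rewrite !indicE in_setU.
      by case: (x \in _); case: (x \in _) => /=; ring.
    apply: multiplierD; first exact: multiplierD.
    by apply: multiplierM; [exact: multiplier_cst|exact: multiplierM].
  apply: (multiplier_cvg (f_ := fun n => \1_(B n)) (M := 1)) => //.
    by move=> n x; rewrite indicE; case: (_ \in _); rewrite ?normr1 ?normr0.
  move=> x; have [[i _ Ax]|nAx] := pselect ((\bigcup_i A i) x).
    apply: cvg_near_cst; near=> n.
    rewrite !indicE !mem_set//; first by exists i.
    have ni : (i < n)%N by near: n; exists i.+1.
    by rewrite /B -bigcup_mkord; exists i.
  apply: cvg_near_cst; near=> n.
  rewrite !indicE !memNset//.
  by rewrite /B -bigcup_mkord => -[i _ Ax]; apply: nAx; exists i.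
Unshelve. all: by end_near. Qed.

End ExpectationDeterminingClass.

(** * From cosines of linear forms to indicators of half-spaces *)

Section CramerWold.
Context (R : realType).

(** A polynomial fixing -1, 0 and 1, the outer two attracting, so its iterates tend to the sign on
    [-1, 1]. Being polynomial, it preserves multipliers. *)
Let sgn_step (s : R) := s * (3 - s ^+ 2) / 2.

Lemma norm_sgn_step s : `|s| <= 1 -> `|sgn_step s| <= 1.
Proof.
rewrite !ler_norml /sgn_step => /andP[h1 h2].
(* The two products are 2 (1 - p) and 2 (1 + p), where p is [sgn_step s]. *)
have e1 : 0 <= (1 - s) ^+ 2 * (2 + s) by rewrite mulr_ge0 ?sqr_ge0//; lra.
have e2 : 0 <= (1 + s) ^+ 2 * (2 - s) by rewrite mulr_ge0 ?sqr_ge0//; lra.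
by apply/andP; split; lra.
Qed.

Lemma norm_iter_sgn_step k s : `|s| <= 1 -> `|iter k sgn_step s| <= 1.
Proof. by move=> s1; elim: k => //= k; exact: norm_sgn_step. Qed.

Lemma iter_sgn_stepN k s : iter k sgn_step (- s) = - iter k sgn_step s.
Proof. by elim: k => //= k ->; rewrite /sgn_step; field. Qed.

(** Iterates t of a positive start increase, hence stay above [s], and 1 - p(t) = (1 - t)(1 - t/2 -
    t^2/2) then contracts the distance to 1 by a factor at most 1 - s/2. *)
Lemma iter_sgn_step_bound k s : 0 < s <= 1 ->
  s <= iter k sgn_step s /\ 1 - (1 - s / 2) ^+ k <= iter k sgn_step s <= 1.
Proof.
move=> /andP[s0 s1]; elim: k => [|k [IH /andP[IH1 IH2]]] /=.
  by split => //; rewrite expr0 subrr s1 (ltW s0).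
set t := iter k sgn_step s in IH IH1 IH2 *.
rewrite exprS; set e := (1 - s / 2) ^+ k in IH1 *.
have e0 : 0 <= e by rewrite exprn_ge0//; lra.
have h1 : t <= sgn_step t.
  have : 0 <= t * ((1 - t) * (1 + t)) by rewrite !mulr_ge0//; lra.
  by rewrite /sgn_step; lra.
have h2 : sgn_step t <= 1.
  have : 0 <= (1 - t) ^+ 2 * (2 + t) by rewrite mulr_ge0 ?sqr_ge0//; lra.
  by rewrite /sgn_step; lra.
split; first exact: le_trans h1.
rewrite h2 andbT.
have h3 : 1 - sgn_step t <= (1 - s / 2) * (1 - t).
  have -> : 1 - sgn_step t = (1 - t) * (1 - t / 2 - t ^+ 2 / 2) by rewrite /sgn_step; field.
  rewrite mulrC ler_wpM2r ?subr_ge0//; nra.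
have h4 : (1 - s / 2) * (1 - t) <= (1 - s / 2) * e by rewrite ler_wpM2l//; lra.
lra.
Qed.

Lemma cvg_iter_sgn_step s : `|s| <= 1 -> (fun k => iter k sgn_step s) @ \oo --> Num.sg s.
Proof.
have pos u : 0 < u <= 1 -> (fun k => iter k sgn_step u) @ \oo --> (1 : R).
  move=> u01; have /andP[u0 u1] := u01.
  apply: (@squeeze_cvgr _ _ _ _ (fun k => 1 - (1 - u / 2) ^+ k) (fun=> 1)).
  - by near=> k; have [_] := iter_sgn_step_bound k u01.
  - rewrite -[X in _ --> X](subr0 1); apply: cvgB; first exact: cvg_cst.
    by apply: cvg_expr; rewrite ger0_norm; lra.
  - exact: cvg_cst.
move=> s1; have [s0|s0|->] := ltgtP s 0.
- rewrite ltr0_sg//.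
  rewrite (_ : (fun k => _) = (fun k => - iter k sgn_step (- s))).
    by apply: cvgN; apply: pos; move: s1; rewrite ltr0_norm//; lra.
  by apply/funext => k; rewrite -iter_sgn_stepN opprK.
- by rewrite gtr0_sg//; apply: pos; move: s1; rewrite gtr0_norm// => ->; rewrite s0.
- rewrite sgr0; apply: cvg_near_cst; apply: nearW => k.
  by elim: k => //= k ->; rewrite /sgn_step !mul0r.
Unshelve. all: by end_near. Qed.

(** Division by k + 1 eventually brings u into the range where sin has the sign of its argument.
    This extracts the sign of an unbounded coordinate from bounded trigonometric functions. *)
Lemma cvg_sgn_sin (u : R) :
  (fun k : nat => Num.sg (sin (u / k.+1%:R))) @ \oo --> Num.sg u.
Proof.
have pos (v : R) : 0 < v -> \forall k \near \oo, 0 < sin (v / k.+1%:R).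
  move=> v0; near=> k; apply: sin2_gt0.
  rewrite divr_gt0//= ltr_pdivrMr//.
  have vk : v <= k%:R by near: k; exact: nbhs_infty_ger.
  by rewrite -natr1; lra.
apply: cvg_near_cst; have [u0|u0|->] := ltgtP u 0.
- have := pos (- u); rewrite oppr_gt0 => /(_ u0); apply: filterS => k.
  by rewrite mulNr sinN oppr_gt0 => h; rewrite !ltr0_sg.
- by apply: filterS (pos u u0) => k h; rewrite !gtr0_sg.
- by near=> k; rewrite mul0r sin0.
Unshelve. all: by end_near. Qed.

Variables (n : nat) (P Q : probability (n.-tuple R) R).

Lemma measurable_lin_form (a : 'rV[R]_n) : measurable_fun setT (lin_form a : n.-tuple R -> R).
Proof.
by apply: measurable_sum => i; apply: measurable_funM => //; exact: measurable_tnth.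
Qed.

Hypothesis PQ : forall (a : 'rV[R]_n) (B : set R), measurable B ->
  P (lin_form a @^-1` B) = Q (lin_form a @^-1` B).

(** Real form of the characters. The phase [c] makes sines available and keeps the class stable
    under the product-to-sum formula. *)
Let G : set (n.-tuple R -> R) :=
  [set g | exists a c, g = fun z => cos (lin_form a z + c)].

Let G1 : G (fun=> 1).
Proof.
exists 0, 0; apply/funext => z; rewrite /lin_form big1 ?addr0 ?cos0// => i _.
by rewrite mxE mul0r.
Qed.

Let GE g : G g -> same_expectation P Q g.
Proof.
move=> [a [c ->]].
have mc : measurable_fun setT (fun t : R => cos (t + c)).
  apply: continuous_measurable_fun => t; apply: continuous_comp; last exact: continuous_cos.
  by apply: cvgD; [exact: cvg_id|exact: cvg_cst].
have ml := measurable_lin_form a.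
split.
  split; first exact: (measurableT_comp mc ml).
  by exists 1 => z; rewrite ler_norml cos_geN1 cos_le1.
have E (m : probability (n.-tuple R) R) :
    (\int[m]_z (cos (lin_form a z + c))%:E =
     \int[pushforward m (lin_form a)]_t (cos (t + c))%:E)%E.
  rewrite integral_pushforward//.
  - exact/measurable_EFinP.
  - apply: (@bounded_mfun_integrable _ _ _ m (fun z => cos (lin_form a z + c))).
    split; first exact: (measurableT_comp mc ml).
    by exists 1 => z; rewrite ler_norml cos_geN1 cos_le1.
rewrite !E; apply: eq_measure_integral => B mB _; exact: PQ.
Qed.

Let lin_formD (a b : 'rV[R]_n) (z : n.-tuple R) :
  lin_form (a + b) z = lin_form a z + lin_form b z :> R.
Proof. by rewrite /lin_form -big_split; apply: eq_bigr => i _; rewrite mxE mulrDl. Qed.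

Let lin_formN (a : 'rV[R]_n) (z : n.-tuple R) : lin_form (- a) z = - lin_form a z :> R.
Proof. by rewrite /lin_form -sumrN; apply: eq_bigr => i _; rewrite mxE mulNr. Qed.

Let GM g g' : G g -> G g' -> exists h h',
  [/\ G h, G h' & forall x, g x * g' x = 2^-1 * h x + 2^-1 * h' x].
Proof.
move=> [a [c ->]] [b [e ->]].
exists (fun z => cos (lin_form (a + b) z + (c + e))),
  (fun z => cos (lin_form (a - b) z + (c - e))); split.
- by exists (a + b), (c + e).
- by exists (a - b), (c - e).
- move=> z; rewrite !lin_formD lin_formN.
  set A := lin_form a z; set B := lin_form b z.
  have -> : A + B + (c + e) = (A + c) + (B + e) by ring.
  have -> : A - B + (c - e) = (A + c) - (B + e) by ring.
  by move: (A + c) (B + e) => X Y; rewrite cosD cosB; field.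
Qed.

Let mult := multiplier P Q G.

Let mult_sgn f : mult f -> (forall z, `|f z| <= 1) -> mult (fun z => Num.sg (f z)).
Proof.
move=> mf f1.
apply: (multiplier_cvg G1 GE (f_ := fun k z => iter k sgn_step (f z)) (M := 1)).
- elim => [|k IH] //=; rewrite /sgn_step.
  rewrite (_ : (fun _ => _) = (fun z => (2^-1 * iter k sgn_step (f z)) *
    (3 + -1 * (iter k sgn_step (f z) * iter k sgn_step (f z))))); last first.
    by apply/funext => z; ring.
  apply: multiplierM; first by apply: multiplierM => //; exact: multiplier_cst.
  apply: multiplierD; first exact: multiplier_cst.
  by apply: multiplierM; [exact: multiplier_cst|exact: multiplierM].
- by move=> k z; exact: norm_iter_sgn_step.
- by move=> z; exact: cvg_iter_sgn_step.
Qed.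

Let mult_coord (i : 'I_n) (c : R) : mult (fun z => Num.sg (tnth z i - c)).
Proof.
apply: (multiplier_cvg G1 GE
  (f_ := fun k z => Num.sg (sin ((tnth z i - c) / k.+1%:R))) (M := 1)).
- move=> k; apply: mult_sgn; last by move=> z; rewrite ler_norml sin_geN1 sin_le1.
  apply: multiplier_G => //.
  (* An element of [G], because sin x = cos (x - pi / 2). *)
  exists (k.+1%:R^-1 *: delta_mx 0 i), (- (c / k.+1%:R) - pi / 2).
  apply/funext => z.
  rewrite (_ : lin_form _ z = tnth z i / k.+1%:R); last first.
    rewrite /lin_form (bigD1 i)//= big1 ?addr0.
      by rewrite !mxE !eqxx mulr1 mulrC.
    by move=> j ji; rewrite !mxE (negbTE ji) andbF mulr0 mul0r.
  by rewrite addrA -mulrBl cosB cos_pihalf sin_pihalf mulr0 add0r mulr1.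
- by move=> k z; rewrite normr_sg; case: (_ != 0).
- by move=> z; exact: cvg_sgn_sin.
Qed.

(** Coordinate half-lines ]c, +oo[ generate the sigma-algebra, so it is enough that their indicators
    are multipliers. *)
Lemma cramer_wold A : measurable A -> P A = Q A.
Proof.
move=> mA; suff mult_A : mult (\1_A : n.-tuple R -> R).
  have [_] := multiplier_same G1 GE mult_A.
  by rewrite !integral_indic// !setIT.
have := sigma_algebra_multiplier G1 GE; set M := (X in sigma_algebra _ X) => sM.
suff : measurable `<=` M by apply.
apply: smallest_sub => // B; rewrite -bigcup_seq => -[i _ [C mC <-]].
rewrite setTI; rewrite /= in mC.
pose N := [set C | M ((fun z : n.-tuple R => tnth z i) @^-1` C)].
have : N C.
  move: mC; rewrite /measurable/= /measurableR RGenOInfty.measurableE.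
  apply: (@smallest_sub _ (sigma_algebra setT) (@RGenOInfty.G R) N).
    split => /=.
    - by rewrite /N/= preimage_set0; case: sM.
    - move=> D MD; have [_ hC _] := sM; have := hC _ MD.
      by rewrite /N/= !setTD preimage_setC.
    - by move=> F MF; rewrite /N/= preimage_bigcup; case: sM => _ _; apply.
  move=> _ [c ->] /=.
  rewrite /N/M/=.
  (* If s is the sign of [tnth z i - c], the indicator of s = 1 is (s^2 + s) / 2. *)
  rewrite (_ : (\1__ : _ -> R) = (fun z => 2^-1 * (Num.sg (tnth z i - c) * Num.sg (tnth z i - c)) +
     2^-1 * Num.sg (tnth z i - c))).
    apply: multiplierD.
      by apply: multiplierM; [exact: multiplier_cst|apply: multiplierM; exact: mult_coord].
    by apply: multiplierM; [exact: multiplier_cst|exact: mult_coord].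
  apply/funext => z; rewrite indicE.
  have -> : (z \in (fun z0 : n.-tuple R => tnth z0 i) @^-1` `]c, +oo[) = (0 < tnth z i - c).
    by apply/idP/idP; rewrite inE/= in_itv/= andbT subr_gt0.
  by case: sgrP => _ /=; field.
exact.
Qed.

End CramerWold.

(** * Gaussian densities *)

Section GaussianProjection.
Context (R : realType) (n : nat).
Local Notation mR := (measurableTypeR R).
Local Notation leb := (@lebesgue_measure R).

Definition centered (m : 'rV[R]_n) (z : n.-tuple R) : 'rV[R]_n :=
  \row_i (tnth z i - m 0 i).

Definition dotr (a v : 'rV[R]_n) : R := \sum_i a 0 i * v 0 i.

(** The energy [q] is abstract because two instances are used: the form of the precision matrix with
    covariance [S], and [star_energy] with covariance [Sigma_star]. Hypothesis [qS] ties [q] to the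
    covariance without an inverse. *)
Variables (m : 'rV[R]_n) (S : 'M[R]_n) (q : 'rV[R]_n -> R) (c : R).
Variable P : probability (n.-tuple R) R.
Hypothesis c0 : 0 <= c.
Hypothesis mq : measurable_fun setT (fun z => q (centered m z)).
Hypothesis PE : forall A, measurable A ->
  P A = (\int[lebn R n]_(z in A) (c * expR (- q (centered m z)))%:E)%E.
(* Completing the square: translating by [a *m S] tilts [exp (- q)] by [exp <a, v>]. *)
Hypothesis qS : forall (a v : 'rV[R]_n) t,
  q (v + t *: (a *m S)) = q v + t * dotr a v + t ^+ 2 / 2 * quad_form a S.

Section Direction.
Variable a : 'rV[R]_n.
Hypothesis s2_gt0 : 0 < quad_form a S.
Let s2 := quad_form a S.
Let s := Num.sqrt s2.
Let mu := \sum_(i < n) a 0 i * m 0 i.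
Let X : n.-tuple R -> R := lin_form a.
(** Up to a constant, the reciprocal of the N(mu, s2) density at [X z]. Reweighting [P] by it turns
    the law of [X] into a multiple of Lebesgue measure; [J] integrates against that reweighted
    law. *)
Let w z := expR ((X z - mu) ^+ 2 / (2 * s2)).

Let mX : measurable_fun setT X. Proof. exact: measurable_lin_form. Qed.

Let mw : measurable_fun setT w.
Proof.
apply: measurableT_comp => //; apply: measurable_funM => //.
by apply: measurable_funX; apply: measurable_funB.
Qed.

Let w0 z : 0 <= w z. Proof. exact: expR_ge0. Qed.

Let J (k : R -> R) := (\int[P]_z (w z * k (X z))%:E)%E.

(** Translating z by t a S with t = y / s2 moves [X] by y. By [qS] the density acquires the factor
    exp(- t (X - mu) - t^2 s2 / 2), and the change of [w] is exactly its inverse. *)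
Let J_shift (k : R -> R) (y : R) : measurable_fun setT k -> (forall x, 0 <= k x) ->
  J (fun x => k (x + y)) = J k.
Proof.
move=> mk k0; rewrite /J.
have md : measurable_fun setT (fun z => c * expR (- q (centered m z))).
  by apply: measurable_funM => //; apply: measurableT_comp => //; exact: measurable_funN.
have d0 z : 0 <= c * expR (- q (centered m z)) by rewrite mulr_ge0// expR_ge0.
have mk' : measurable_fun setT (fun z => k (X z + y)).
  by apply: measurableT_comp => //; exact: measurable_funD.
have mkX : measurable_fun setT (fun z => k (X z)) by exact: measurableT_comp.
rewrite (ge0_integral_density md d0 PE); last 2 first.
- by move=> z; rewrite lee_fin mulr_ge0.
- by apply/measurable_EFinP; exact: measurable_funM.
rewrite (ge0_integral_density md d0 PE); last 2 first.
- by move=> z; rewrite lee_fin mulr_ge0.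
- by apply/measurable_EFinP; exact: measurable_funM.
pose t := y / s2.
have s20 : s2 != 0 by rewrite gt_eqF.
pose h (i : 'I_n) := (t *: (a *m S)) 0 i.
rewrite -[RHS](ge0_integral_lebn_shift h); last 2 first.
- by move=> z; rewrite -EFinM lee_fin !mulr_ge0.
- by under eq_fun do rewrite -EFinM; apply/measurable_EFinP; do 2 apply: measurable_funM => //.
apply: eq_integral => z _; rewrite -!EFinM; congr EFin.
have XhE : X (shift_tuple h z) = X z + y.
  rewrite /X /lin_form.
  under eq_bigr do rewrite tnth_mktuple mulrDr.
  rewrite big_split/=; congr (_ + _).
  rewrite (_ : \sum_i _ = t * s2); first by rewrite /t divfK.
  rewrite /s2 /quad_form mxE mulr_sumr; apply: eq_bigr => i _.
  by rewrite /h !mxE; ring.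
rewrite XhE.
have -> : centered m (shift_tuple h z) = centered m z + t *: (a *m S).
  by apply/rowP => i; rewrite mxE tnth_mktuple !mxE /h !mxE; ring.
rewrite qS -/s2.
have -> : dotr a (centered m z) = X z - mu.
  rewrite /dotr /X /lin_form /mu -sumrB; apply: eq_bigr => i _.
  by rewrite mxE mulrBr.
(* Applied once to each side of the goal, to bring the weight and the exponential together in one
   exponent. *)
have -> A K e : A * K * (c * e) = K * c * (A * e) :> R by ring.
have -> A K e : A * K * (c * e) = K * c * (A * e) :> R by ring.
congr (_ * _); rewrite /w -!expRD; congr expR.
rewrite XhE.
rewrite /t; field.
exact: s20.
Qed.

(** Uniqueness of translation-invariant measures: insert psi(y - X), of unit integral in y, exchange
    integrals, translate by y, exchange back. The weight stays in the integrand, so Tonelli is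
    applied to [P] and Lebesgue measure. *)
Let J_lebesgue (k : R -> R) : measurable_fun setT k -> (forall x, 0 <= k x) ->
  J k = (J (fun x => normal_pdf 0 1 (- x)) * \int[leb]_x (k x)%:E)%E.
Proof.
move=> mk k0.
pose psi : R -> R := normal_pdf 0 1.
have mpsi : measurable_fun setT psi by exact: measurable_normal_pdf.
have psi0 x : 0 <= psi x by exact: normal_pdf_ge0.
have mX1 : measurable_fun setT (fun p : n.-tuple R * mR => X p.1).
  by apply: (measurableT_comp mX); exact: measurable_fst.
have mw1 : measurable_fun setT (fun p : n.-tuple R * mR => w p.1).
  by apply: (measurableT_comp mw); exact: measurable_fst.
have m2 : measurable_fun setT (fun p : n.-tuple R * mR => p.2 : R).
  by have := @measurable_snd _ _ (n.-tuple R) mR; exact.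
pose f (p : n.-tuple R * mR) : \bar R := (w p.1 * (k (X p.1) * psi (p.2 - X p.1)))%:E.
have mf : measurable_fun setT f.
  apply/measurable_EFinP; apply: measurable_funM => //; apply: measurable_funM.
    exact: (measurableT_comp mk mX1).
  by apply: (measurableT_comp mpsi); exact: measurable_funB.
pose g (p : n.-tuple R * mR) : \bar R := (w p.1 * (k (X p.1 + p.2) * psi (- X p.1)))%:E.
have mg : measurable_fun setT g.
  apply/measurable_EFinP; apply: measurable_funM => //; apply: measurable_funM.
    by apply: (measurableT_comp mk); exact: measurable_funD.
  by apply: (measurableT_comp mpsi); exact: measurable_funN.
have f0 p : (0 <= f p)%E by rewrite lee_fin !mulr_ge0.
have g0 p : (0 <= g p)%E by rewrite lee_fin !mulr_ge0.
transitivity (\int[P]_z \int[leb]_y f (z, y))%E.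
  apply: eq_integral => z _; rewrite /f/=.
  under eq_integral do rewrite mulrA EFinM.
  have mps : measurable_fun setT (fun y : mR => (psi (y - X z))%:E).
    apply/measurable_EFinP.
    apply: (measurableT_comp mpsi).
    by have := measurable_funB (@measurable_id _ R setT) (@measurable_cst _ _ R R setT (X z)).
  rewrite ge0_integralZl//; last 2 first.
  - by move=> y _; rewrite lee_fin.
  - by rewrite lee_fin mulr_ge0.
  rewrite (ge0_integral_lebesgue_shift (- X z) (f := fun y => (psi y)%:E)).
  - by rewrite integral_normal_pdf mule1.
  - by move=> y; rewrite lee_fin.
  - exact/measurable_EFinP.
rewrite (fubini_tonelli _ mf)//.
transitivity (\int[leb]_y \int[P]_z g (z, y))%E.
  apply: eq_integral => y _.
  transitivity (J (fun x => k x * psi (y - x))); first by [].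
  rewrite -(J_shift (k := fun x => k x * psi (y - x)) y).
  - apply: eq_integral => z _; rewrite /g/=; congr (_ * (_ * psi _))%:E.
    by ring.
  - apply: measurable_funM => //; apply: (measurableT_comp mpsi).
    exact: measurable_funB.
  - by move=> x; rewrite mulr_ge0.
rewrite -(fubini_tonelli _ mg)//.
have mk0 : measurable_fun setT (EFin \o k) by exact/measurable_EFinP.
rewrite -ge0_integralZr//; last 3 first.
- apply/measurable_EFinP; apply: measurable_funM => //.
  by apply: (measurableT_comp mpsi); exact: measurable_funN.
- by move=> z _; rewrite lee_fin mulr_ge0.
- by apply: integral_ge0 => x _; rewrite lee_fin.
apply: eq_integral => z _; rewrite /g/=.
under eq_integral do rewrite (mulrC (k _)) mulrA EFinM.
have mks : measurable_fun setT (fun y : mR => (k (X z + y))%:E).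
  apply/measurable_EFinP; apply: (measurableT_comp mk).
  by have := measurable_funD (@measurable_cst _ _ R R setT (X z)) (@measurable_id _ R setT).
rewrite ge0_integralZl//; last 2 first.
- by move=> y _; rewrite lee_fin.
- by rewrite lee_fin mulr_ge0.
congr (_ * _)%E.
under eq_integral do rewrite addrC.
rewrite (ge0_integral_lebesgue_shift (X z) (f := fun y => (k y)%:E))//.
Qed.

(** Apply [J_lebesgue] to [\1_D] times the normal density: the weight cancels its exponential and
    leaves the peak times P(X in D). The unknown constant is read off at D = setT, both sides being
    probabilities. *)
Lemma gaussian_projection (B : set R) : measurable B ->
  P (X @^-1` B) = normal_prob mu s B.
Proof.
move=> mB.
have s0 : s != 0 by rewrite gt_eqF// sqrtr_gt0.
pose pk := normal_peak s.
have pk0 : 0 < pk by exact: normal_peak_gt0.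
have JB D : measurable D ->
    (pk%:E * P (X @^-1` D) = J (fun x => normal_pdf 0 1 (- x)) * normal_prob mu s D)%E.
  move=> mD; pose k x := \1_D x * normal_pdf mu s x.
  have mk : measurable_fun setT k.
    apply: measurable_funM; first exact: measurable_indic.
    exact: measurable_normal_pdf.
  have mXD : measurable (X @^-1` D) by rewrite -[X in measurable X]setTI; exact: mX.
  have <- : (\int[leb]_x (k x)%:E = normal_prob mu s D)%E.
    rewrite /normal_prob [RHS]integral_mkcond; apply: eq_integral => x _.
    by rewrite /k epatch_indic EFinM muleC.
  rewrite -J_lebesgue//; last by move=> x; rewrite mulr_ge0// normal_pdf_ge0.
  rewrite /J.
  transitivity (\int[P]_z (pk%:E * (\1_(X @^-1` D) z)%:E))%E.
    rewrite ge0_integralZl//; last 2 first.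
    - by apply/measurable_EFinP; exact: measurable_indic.
    - by rewrite lee_fin ltW.
    by rewrite integral_indic// setIT.
  apply: eq_integral => z _; rewrite -EFinM; congr EFin.
  rewrite /k normal_pdfE// /w /normal_fun !indicE.
  have -> : (z \in X @^-1` D) = (X z \in D) by apply/idP/idP; rewrite !inE.
  have -> : s ^+ 2 *+ 2 = 2 * s2.
    by rewrite sqr_sqrtr ?(ltW s2_gt0)// -mulr_natl.
  rewrite mulrCA [expR _ * _]mulrCA -expRD mulNr addrN expR0 mulr1.
  by rewrite mulrC.
have C : J (fun x => normal_pdf 0 1 (- x)) = pk%:E.
  have := JB setT measurableT.
  by rewrite preimage_setT !probability_setT !mule1.
have := JB B mB; rewrite C => e.
by apply/eqP; rewrite eq_le; apply/andP; split; rewrite -(@lee_pmul2l _ pk%:E)// e.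
Qed.

End Direction.

Lemma density_is_gaussian : (forall a, a != 0 -> 0 < quad_form a S) ->
  is_gaussian P m S.
Proof.
move=> S0 a B mB; have [->|a0] := eqVneq a 0.
  have -> : quad_form 0 S = 0 by rewrite /quad_form !mul0mx mxE.
  rewrite eqxx.
  have l0 z : lin_form 0 z = 0 :> R by rewrite /lin_form big1// => i _; rewrite mxE mul0r.
  rewrite big1; last by move=> i _; rewrite mxE mul0r.
  rewrite diracE; have [B0|B0] := boolP (0 \in B).
    rewrite (_ : _ @^-1` _ = setT) ?probability_setT//.
    by apply/seteqP; split => z //= _; rewrite l0; exact: set_mem B0.
  rewrite (_ : _ @^-1` _ = set0) ?measure0//.
  by apply/seteqP; split => z //=; rewrite l0 => /mem_set; rewrite (negbTE B0).
rewrite gt_eqF ?S0//; exact: gaussian_projection (S0 _ a0) _ mB.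
Qed.

End GaussianProjection.

(** * Quadratic forms of the precision matrix and of the star covariance *)

Section QuadraticForms.
Context (R : realType).

Lemma dotrE d (a v : 'rV[R]_d) : dotr a v = (a *m v^T) 0 0.
Proof. by rewrite mxE; apply: eq_bigr => i _; rewrite mxE. Qed.

Section Inverse.
Context (d : nat) (S : 'M[R]_d).
Hypothesis pS : posdef S.
Let Q := invmx S.

Lemma posdef_unitmx : S \in unitmx.
Proof.
rewrite -row_free_unit; apply: inj_row_free => v vS.
apply/eqP; apply/negPn/negP => v0; have := pS.2 _ v0.
by rewrite /quad_form vS mul0mx mxE ltxx.
Qed.

Lemma invmx_sym : Q^T = Q.
Proof. by rewrite trmx_inv pS.1. Qed.

(** This is [qS] for the energy of N(m, S): as S Q = 1, the cross term collapses to the linear form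
    in v. *)
Lemma quad_form_invmx_shift (a v : 'rV[R]_d) t :
  quad_form (v + t *: (a *m S)) Q / 2 =
  quad_form v Q / 2 + t * dotr a v + t ^+ 2 / 2 * quad_form a S.
Proof.
have uS := posdef_unitmx.
have e1 : quad_form (v + t *: (a *m S)) Q =
    quad_form v Q + t * (v *m Q *m (a *m S)^T) 0 0 +
    t * (a *m v^T) 0 0 + t ^+ 2 * quad_form a S.
  have -> : quad_form a S = (a *m (a *m S)^T) 0 0.
    by rewrite /quad_form trmx_mul pS.1 mulmxA.
  rewrite /quad_form linearD linearZ/= !mulmxDl !mulmxDr.
  rewrite -!scalemxAl -!scalemxAr !(mulmxK uS).
  move: (_ *m v^T) (_ *m v^T) (_ *m (a *m S)^T) (_ *m (a *m S)^T) => A B C D.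
  by rewrite !mxE; ring.
have e2 : (v *m Q *m (a *m S)^T) = v *m a^T.
  by rewrite trmx_mul pS.1 mulmxA (mulmxKV uS).
have dC : dotr v a = dotr a v by apply: eq_bigr => i _; rewrite mulrC.
by rewrite e1 e2 -!dotrE dC; field.
Qed.

Lemma quad_form_invmx_gt0 (v : 'rV[R]_d) : v != 0 -> 0 < quad_form v Q.
Proof.
have uS := posdef_unitmx => v0.
have -> : quad_form v Q = quad_form (v *m Q) S.
  by rewrite /quad_form (mulmxKV uS) trmx_mul invmx_sym mulmxA.
apply: pS.2; apply: contraNneq v0 => vQ.
by rewrite -(mulmxKV uS v) vQ mul0mx.
Qed.

Lemma quad_form_delta (M : 'M[R]_d) i : quad_form (delta_mx 0 i) M = M i i.
Proof.
rewrite /quad_form -rowE mxE (bigD1 i)//= big1 ?addr0.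
  by rewrite !mxE !eqxx mulr1.
by move=> j ji; rewrite !mxE (negbTE ji) andbF mulr0.
Qed.

Lemma delta_mx_neq0 i : delta_mx 0 i != 0 :> 'rV[R]_d.
Proof.
by apply/eqP => /rowP/(_ i)/eqP; rewrite !mxE !eqxx oner_eq0.
Qed.

Lemma posdef_diag_gt0 i : 0 < S i i.
Proof. by rewrite -quad_form_delta; apply: pS.2; exact: delta_mx_neq0. Qed.

Lemma invmx_diag_gt0 i : 0 < Q i i.
Proof. by rewrite -quad_form_delta; apply: quad_form_invmx_gt0; exact: delta_mx_neq0. Qed.

Lemma dotr_delta i (v : 'rV[R]_d) : dotr (delta_mx 0 i) v = v 0 i.
Proof.
rewrite /dotr (bigD1 i)//= big1 ?addr0; first by rewrite mxE !eqxx mul1r.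
by move=> j ji; rewrite mxE (negbTE ji) andbF mul0r.
Qed.

(* Cauchy-Schwarz: minimise over [t] the energy of [v - t e_i S]. *)
Lemma quad_form_invmx_coord (v : 'rV[R]_d) i : v 0 i ^+ 2 / S i i <= quad_form v Q.
Proof.
have Si := posdef_diag_gt0 i.
have := quad_form_invmx_shift (delta_mx 0 i) v (- (v 0 i / S i i)).
rewrite quad_form_delta dotr_delta.
set u := v + _ => e.
have : 0 <= quad_form u Q.
  have [->|u0] := eqVneq u 0; first by rewrite /quad_form !mul0mx mxE.
  exact/ltW/quad_form_invmx_gt0.
have -> : v 0 i ^+ 2 / S i i = v 0 i / S i i * v 0 i by ring.
have : (- (v 0 i / S i i)) ^+ 2 / 2 * S i i = v 0 i / S i i * v 0 i / 2.
  by field; rewrite gt_eqF.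
by move=> e2 u0; move: e; rewrite e2; lra.
Qed.

End Inverse.

Section Star.
Context (k : nat) (S : 'M[R]_k.+1).
Hypothesis pS : posdef S.
Let Q := invmx S.

Definition cond_slope (j : 'I_k) : R := (S ord0 ord0)^-1 * S ord0 (lift ord0 j).

(* Residual of coordinate [j] after regression on coordinate 0. *)
Definition residual (v : 'rV[R]_k.+1) (j : 'I_k) : R :=
  v 0 (lift ord0 j) - cond_slope j * v 0 ord0.

(** Minus the log-density of the projection at displacement [v] from the mean, up to a constant:
    head and residuals are independent, with precisions 1/S_00 and Q_jj. *)
Definition star_energy (v : 'rV[R]_k.+1) : R :=
  (v 0 ord0 ^+ 2 / S ord0 ord0 +
   \sum_j Q (lift ord0 j) (lift ord0 j) * residual v j ^+ 2) / 2.

Let S00 : 0 < S ord0 ord0. Proof. exact: posdef_diag_gt0. Qed.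
Let S00n : S ord0 ord0 != 0. Proof. by rewrite gt_eqF. Qed.
Let Qn j : Q j j != 0. Proof. by rewrite gt_eqF// invmx_diag_gt0. Qed.

(** Write v = w + (v_0 / S_00) e_0 S, where w has zero head and the residuals as tail. In the shift
    formula the cross term is w_0 = 0, so the square splits and only the lower block of Q acts on
    the residuals. *)
Lemma quad_form_invmx_residual (v : 'rV[R]_k.+1) :
  quad_form v Q = v 0 ord0 ^+ 2 / S ord0 ord0 +
    \sum_i \sum_j Q (lift ord0 i) (lift ord0 j) * (residual v i * residual v j).
Proof.
pose w : 'rV[R]_k.+1 := \row_i (if unlift ord0 i is Some j then residual v j else 0).
have w0 : w 0 ord0 = 0 by rewrite mxE unlift_none.
have wS j : w 0 (lift ord0 j) = residual v j by rewrite mxE liftK.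
have vE : v = w + (v 0 ord0 / S ord0 ord0) *: (delta_mx 0 ord0 *m S).
  apply/rowP => i; rewrite -rowE !mxE; case: unliftP => [j|] ->.
    by rewrite /residual /cond_slope; ring.
  by rewrite add0r divfK.
clearbody w.
have := quad_form_invmx_shift pS (delta_mx 0 ord0) w (v 0 ord0 / S ord0 ord0).
rewrite -vE quad_form_delta dotr_delta w0 mulr0 addr0 -/Q => e.
have -> : quad_form v Q = quad_form w Q + v 0 ord0 ^+ 2 / S ord0 ord0.
  have e2 : (v 0 ord0 / S ord0 ord0) ^+ 2 / 2 * S ord0 ord0 =
    v 0 ord0 ^+ 2 / S ord0 ord0 / 2 by field.
  by move: e; rewrite e2; lra.
rewrite addrC; congr (_ + _).
have -> : quad_form w Q = \sum_j \sum_i w 0 i * Q i j * w 0 j.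
  by rewrite /quad_form mxE; apply: eq_bigr => j _; rewrite !mxE mulr_suml.
rewrite big_ord_recl big1 ?add0r; last by move=> i _; rewrite w0 mulr0.
rewrite exchange_big/= big_ord_recl big1 ?add0r; last first.
  by move=> j _; rewrite w0 !mul0r.
by apply: eq_bigr => i _; apply: eq_bigr => j _; rewrite !wS; ring.
Qed.

Lemma Sigma_star_row0 (a : 'rV[R]_k.+1) :
  (a *m Sigma_star S) 0 ord0 = \sum_i a 0 i * S ord0 i.
Proof.
rewrite mxE; apply: eq_bigr => i _; rewrite mxE.
by rewrite eqxx; case: eqP => [->|].
Qed.

(** Covariance form of the model z_j = slope_j z_0 + independent noise of variance 1/Q_jj, up to
    centring. *)
Lemma Sigma_star_rowS (a : 'rV[R]_k.+1) j :
  (a *m Sigma_star S) 0 (lift ord0 j) =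
  cond_slope j * (a *m Sigma_star S) 0 ord0 +
  a 0 (lift ord0 j) / Q (lift ord0 j) (lift ord0 j).
Proof.
have E i : Sigma_star S (lift ord0 i) (lift ord0 j) =
    cond_slope j * S ord0 (lift ord0 i) +
    (if i == j then (Q (lift ord0 j) (lift ord0 j))^-1 else 0).
  rewrite mxE/= (inj_eq lift_inj) /cond_slope; case: eqP => [->|_].
    by rewrite -/Q addrC; congr (_ + _); ring.
  by rewrite addr0; ring.
rewrite Sigma_star_row0 mxE !big_ord_recl mulrDr -addrA; congr (_ + _).
  by rewrite mxE/= /cond_slope; field.
under eq_bigr => i _ do rewrite E mulrDr.
rewrite big_split/= mulr_sumr; congr (_ + _).
  by apply: eq_bigr => i _; ring.
rewrite (bigD1 j)//= eqxx big1 ?addr0// => i ij.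
by rewrite (negbTE ij) mulr0.
Qed.

Lemma residual_shift (a v : 'rV[R]_k.+1) t j :
  residual (v + t *: (a *m Sigma_star S)) j =
  residual v j + t * (a 0 (lift ord0 j) / Q (lift ord0 j) (lift ord0 j)).
Proof.
rewrite /residual.
have E i : (v + t *: (a *m Sigma_star S)) 0 i = v 0 i + t * (a *m Sigma_star S) 0 i.
  by rewrite mxE [in LHS]mxE.
by rewrite !E Sigma_star_rowS; ring.
Qed.

Let row0_slope (a : 'rV[R]_k.+1) :
  (a *m Sigma_star S) 0 ord0 / S ord0 ord0 =
  a 0 ord0 + \sum_j a 0 (lift ord0 j) * cond_slope j.
Proof.
rewrite Sigma_star_row0 big_ord_recl mulrDl mulfK//; congr (_ + _).
rewrite mulr_suml; apply: eq_bigr => j _; rewrite /cond_slope; ring.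
Qed.

(** The variance of the projection on [a], split over the independent variables z_0 and the
    residuals; positivity can be read from the sum of squares. *)
Lemma quad_form_Sigma_star (a : 'rV[R]_k.+1) :
  quad_form a (Sigma_star S) = (a *m Sigma_star S) 0 ord0 ^+ 2 / S ord0 ord0 +
   \sum_j a 0 (lift ord0 j) ^+ 2 / Q (lift ord0 j) (lift ord0 j).
Proof.
have -> : quad_form a (Sigma_star S) = \sum_i (a *m Sigma_star S) 0 i * a 0 i.
  by rewrite /quad_form mxE; apply: eq_bigr => i _; rewrite [a^T i 0]mxE.
rewrite big_ord_recl expr2 -mulrA row0_slope mulrDr -addrA; congr (_ + _).
rewrite mulr_sumr -big_split/=; apply: eq_bigr => j _.
rewrite Sigma_star_rowS; ring.
Qed.

Lemma quad_form_Sigma_star_gt0 (a : 'rV[R]_k.+1) : a != 0 ->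
  0 < quad_form a (Sigma_star S).
Proof.
move=> a0; rewrite quad_form_Sigma_star.
have Qj j : 0 < Q (lift ord0 j) (lift ord0 j) by exact: invmx_diag_gt0.
have h1 : 0 <= (a *m Sigma_star S) 0 ord0 ^+ 2 / S ord0 ord0.
  by rewrite divr_ge0 ?sqr_ge0// ltW.
have h2 j : 0 <= a 0 (lift ord0 j) ^+ 2 / Q (lift ord0 j) (lift ord0 j).
  by rewrite divr_ge0 ?sqr_ge0// ltW.
have [/existsP[j aj]|] := boolP [exists j : 'I_k, a 0 (lift ord0 j) != 0].
  rewrite ltr_wpDl// (bigD1 j)//= ltr_pwDl ?sumr_ge0//.
  by rewrite divr_gt0// exprn_even_gt0.
move=> /existsPn aj.
have {}aj j : a 0 (lift ord0 j) = 0 by apply/eqP; have := aj j; rewrite negbK.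
rewrite ltr_pwDl ?sumr_ge0// divr_gt0// exprn_even_gt0//=.
rewrite Sigma_star_row0 big_ord_recl big1 ?addr0; last first.
  by move=> j _; rewrite aj mul0r.
rewrite mulf_neq0//; apply: contraNneq a0 => a00.
apply/eqP/rowP => i; rewrite mxE; case: (unliftP ord0 i) => [j ->|->] //.
Qed.

(** This is [qS] for the projection: in the coordinates head and residuals the energy is diagonal,
    and the square is completed term by term. *)
Lemma star_energy_shift (a v : 'rV[R]_k.+1) t :
  star_energy (v + t *: (a *m Sigma_star S)) =
  star_energy v + t * dotr a v + t ^+ 2 / 2 * quad_form a (Sigma_star S).
Proof.
rewrite /star_energy quad_form_Sigma_star.
have -> : (v + t *: (a *m Sigma_star S)) 0 ord0 =
    v 0 ord0 + t * (a *m Sigma_star S) 0 ord0 by rewrite mxE [in LHS]mxE.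
set s0 := (a *m _) 0 ord0.
pose r j := residual v j.
have -> : dotr a v = v 0 ord0 * (s0 / S ord0 ord0) + \sum_j a 0 (lift ord0 j) * r j.
  rewrite row0_slope /dotr big_ord_recl mulrDr -addrA; congr (_ + _); first by ring.
  rewrite mulr_sumr -big_split/=; apply: eq_bigr => j _.
  by rewrite /r /residual; ring.
have -> : \sum_j Q (lift ord0 j) (lift ord0 j) *
      residual (v + t *: (a *m Sigma_star S)) j ^+ 2 =
    \sum_j Q (lift ord0 j) (lift ord0 j) * r j ^+ 2 +
    2 * t * (\sum_j a 0 (lift ord0 j) * r j) +
    t ^+ 2 * (\sum_j a 0 (lift ord0 j) ^+ 2 / Q (lift ord0 j) (lift ord0 j)).
  rewrite !mulr_sumr -!big_split/=; apply: eq_bigr => j _.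
  rewrite residual_shift -/(r j); field; exact: Qn.
by field.
Qed.

End Star.
End QuadraticForms.

(** * Gaussian kernels and densities with the star structure *)

Section NormalKernel.
Context (R : realType).
Local Notation mR := (measurableTypeR R).
Local Notation leb := (@lebesgue_measure R).

(** Moving the mean into the argument reduces joint measurability in mean and point to that of one
    fixed density. *)
Lemma normal_pdf_center (c s x : R) : s != 0 -> normal_pdf c s x = normal_pdf 0 s (x - c).
Proof. by move=> s0; rewrite !normal_pdfE// /normal_fun subr0. Qed.

Lemma measurable_normal_pdf_comp d (X : measurableType d) (f g : X -> R) (s : R) :
  s != 0 -> measurable_fun setT f -> measurable_fun setT g ->
  measurable_fun setT (fun x => normal_pdf (f x) s (g x)).
Proof.
move=> s0 mf mg; under eq_fun do rewrite normal_pdf_center//.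
apply: (measurableT_comp (measurable_normal_pdf 0 s)).
exact: measurable_funB.
Qed.

Lemma normal_prob_indic (c s : R) (A : set R) : measurable A ->
  normal_prob c s A = (\int[leb]_x (\1_A x * normal_pdf c s x)%:E)%E.
Proof.
move=> mA; rewrite /normal_prob [LHS]integral_mkcond; apply: eq_integral => x _.
by rewrite epatch_indic EFinM muleC.
Qed.

Variables (f : mR -> R) (s : R).

Definition normal_ker of measurable_fun setT f & s != 0 :=
  fun x : mR => normal_prob (f x) s : {measure set mR -> \bar R}.

Hypothesis mf : measurable_fun setT f.
Hypothesis s0 : s != 0.

Let m_ker U : measurable U -> measurable_fun setT (normal_ker mf s0 ^~ U).
Proof.
move=> mU.
have -> : normal_ker mf s0 ^~ U =
    fun x => (\int[leb]_y (\1_U y * normal_pdf (f x) s y)%:E)%E.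
  by apply/funext => x; exact: normal_prob_indic.
pose F (p : mR * mR) : \bar R := (\1_U p.2 * normal_pdf (f p.1) s p.2)%:E.
have m2 : measurable_fun setT (fun p : mR * mR => p.2 : R).
  by have := @measurable_snd _ _ mR mR; exact.
apply: (@measurable_fun_fubini_tonelli_F _ _ mR mR R leb F).
- apply/measurable_EFinP; apply: measurable_funM.
    exact: (measurableT_comp (@measurable_indic _ mR R setT U mU) (@measurable_snd _ _ mR mR)).
  exact: (measurable_normal_pdf_comp s0 (measurableT_comp mf (@measurable_fst _ _ mR mR)) m2).
- by move=> p; rewrite lee_fin mulr_ge0// normal_pdf_ge0.
Qed.

HB.instance Definition _ := isKernel.Build _ _ _ _ _ (normal_ker mf s0) m_ker.

Let ker_prob x : normal_ker mf s0 x setT = 1%E.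
Proof. by rewrite /normal_ker/= probability_setT. Qed.

HB.instance Definition _ :=
  Kernel_isProbability.Build _ _ _ _ _ (normal_ker mf s0) ker_prob.

End NormalKernel.

Lemma measurable_rect_set (R : realType) n (A : 'I_n -> set R) :
  (forall i, measurable (A i)) -> measurable (rect_set A).
Proof.
move=> mA.
have -> : rect_set A = \bigcap_(i in [set: 'I_n]) ((fun z : n.-tuple R => tnth z i) @^-1` A i).
  by apply/seteqP; split => z /= zA i; [move=> _; exact: zA|exact: (zA i I)].
apply: fin_bigcap_measurable; first exact: finite_finset.
move=> i _; rewrite -[X in measurable X]setTI.
exact: (measurable_tnth (T := R) i measurableT (mA i)).
Qed.

Lemma indic_rect_set (R : realType) n (A : 'I_n -> set R) z :
  \1_(rect_set A) z = \prod_i \1_(A i) (tnth z i) :> R.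
Proof.
have [zA|nzA] := pselect (rect_set A z).
  rewrite indicE mem_set// big1// => i _.
  by rewrite indicE mem_set//; exact: zA.
rewrite indicE memNset//.
have [i Ai] : exists i, ~ A i (tnth z i).
  apply: contrapT => /forallNP h; apply: nzA => i; apply: contrapT; exact: h.
by rewrite (bigD1 i)//= indicE memNset// mul0r.
Qed.

Section StarDensity.
Context (R : realType) (k : nat) (m : 'rV[R]_k.+1) (S : 'M[R]_k.+1).
Hypothesis pS : posdef S.
Local Notation mR := (measurableTypeR R).
Local Notation leb := (@lebesgue_measure R).
Local Notation Q := (invmx S).

Definition marg_sd : R := Num.sqrt (S ord0 ord0).
Definition star_sd (j : 'I_k) : R := Num.sqrt ((Q (lift ord0 j) (lift ord0 j))^-1).

Lemma marg_sd_neq0 : marg_sd != 0.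
Proof. by rewrite gt_eqF// sqrtr_gt0 posdef_diag_gt0. Qed.

Lemma star_sd_neq0 j : star_sd j != 0.
Proof. by rewrite gt_eqF// sqrtr_gt0 invr_gt0 invmx_diag_gt0. Qed.

Lemma measurable_mstar j : measurable_fun setT (mstar m S j : mR -> R).
Proof.
apply: measurable_funD => //; apply: measurable_funM => //.
by apply: measurable_funB => //; exact: measurable_id.
Qed.

(** Lebesgue density of the measure called rho_u in the overview. *)
Definition star_density (u : 'I_k -> R -> R) (z : k.+1.-tuple R) : R :=
  normal_pdf (m 0 ord0) marg_sd (tnth z ord0) *
  \prod_j normal_pdf (mstar m S j (tnth z ord0) + u j (tnth z ord0)) (star_sd j)
            (tnth z (lift ord0 j)).

Lemma star_density_ge0 u z : 0 <= star_density u z.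
Proof.
by rewrite mulr_ge0 ?normal_pdf_ge0// prodr_ge0// => j _; exact: normal_pdf_ge0.
Qed.

Variable u : 'I_k -> R -> R.
Hypothesis mu : forall j, measurable_fun setT (u j).

Let mcm j : measurable_fun setT (fun x : mR => mstar m S j x + u j x).
Proof. by apply: measurable_funD; [exact: measurable_mstar|exact: mu]. Qed.

Lemma measurable_star_density : measurable_fun setT (star_density u).
Proof.
apply: measurable_funM.
  apply: measurable_normal_pdf_comp => //; first exact: marg_sd_neq0.
  exact: (measurable_tnth (T := R)).
apply: measurable_prod => j _; apply: measurable_normal_pdf_comp.
- exact: star_sd_neq0.
- by apply: (measurableT_comp (mcm j)); exact: (measurable_tnth (T := R)).
- exact: (measurable_tnth (T := R)).
Qed.

Definition star_ker (j : 'I_k) : R.-pker mR ~> mR := normal_ker (mcm j) (star_sd_neq0 j).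

Lemma integral_star_density_rect (A : 'I_k.+1 -> set R) : (forall i, measurable (A i)) ->
  (\int[lebn R k.+1]_(z in rect_set A) (star_density u z)%:E =
   star_prod (normal_prob (m 0%R ord0) marg_sd) (fun j x => star_ker j x) A)%E.
Proof.
move=> mA.
have mr := measurable_rect_set mA.
have mprod : measurable_fun setT (fun x : mR =>
    \prod_(j < k) fine (star_ker j x (A (lift ord0 j)))).
  apply: measurable_prod => j _.
  exact: (measurableT_comp (fine_measurable measurableT) (measurable_kernel (star_ker j) _ (mA _))).
have prod0 x : 0 <= \prod_(j < k) fine (star_ker j x (A (lift ord0 j))).
  by apply: prodr_ge0 => j _; exact: fine_ge0.
rewrite /star_prod [RHS]integral_mkcond.
transitivity (\int[leb]_x ((\1_(A ord0) x)%:E *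
  (\prod_(j < k) fine (star_ker j x (A (lift ord0 j))))%:E *
  (normal_pdf (m 0%R ord0) marg_sd x)%:E))%E; last first.
  have PE (D : set mR) : measurable D -> normal_prob (m 0 ord0) marg_sd D =
    (\int[leb]_(x in D) (normal_pdf (m 0%R ord0) marg_sd x)%:E)%E by [].
  rewrite -(@ge0_integral_density _ mR R leb (normal_prob (m 0 ord0) marg_sd) _
    (measurable_normal_pdf (m 0 ord0) marg_sd)
    (normal_pdf_ge0 (m 0 ord0) marg_sd) PE (fun x => ((\1_(A ord0) x)%:E *
      (\prod_(j < k) fine (star_ker j x (A (lift ord0 j))))%:E)%E)).
  - by apply: eq_integral => x _; rewrite epatch_indic muleC.
  - by move=> x; rewrite mule_ge0// lee_fin.
  - apply: emeasurable_funM; last by apply/measurable_EFinP; exact: mprod.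
    by apply/measurable_EFinP; exact: (@measurable_indic _ mR R setT _ (mA ord0)).
rewrite [LHS]integral_mkcond.
have -> : ((fun z => (star_density u z)%:E) \_ (rect_set A))%E =
    (fun z => (\1_(rect_set A) z * star_density u z)%:E).
  by apply/funext => z; rewrite epatch_indic EFinM muleC.
rewrite integral_lebnS; last 2 first.
- by move=> z; rewrite lee_fin mulr_ge0// star_density_ge0.
- apply/measurable_EFinP; apply: measurable_funM; first exact: measurable_indic.
  exact: measurable_star_density.
apply: eq_integral => x _.
pose G j (y : mR) : \bar R := (\1_(A (lift ord0 j)) y *
   normal_pdf (mstar m S j x + u j x) (star_sd j) y)%:E.
have G0 j y : (0 <= G j y)%E by rewrite lee_fin mulr_ge0// normal_pdf_ge0.
have mG j : measurable_fun setT (G j).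
  apply/measurable_EFinP; apply: measurable_funM.
    exact: (@measurable_indic _ mR R setT _ (mA (lift ord0 j))).
  exact: measurable_normal_pdf.
transitivity (\int[lebn R k]_t ((\1_(A ord0) x * normal_pdf (m 0%R ord0) marg_sd x)%:E *
    \prod_j G j (tnth t j)))%E.
  apply: eq_integral => t _.
  rewrite indic_rect_set big_ord_recl /star_density /G prodEFin -EFinM; congr EFin.
  rewrite big_split/= mulrACA; congr (_ * (_ * _)).
    by apply: eq_bigr => j _; rewrite tnthS.
  by apply: eq_bigr => j _; rewrite tnthS.
rewrite ge0_integralZl//; last 3 first.
- apply: emeasurable_prod => j.
  exact: (measurableT_comp (mG j) (measurable_tnth (T := R) j)).
- by move=> t _; apply: prode_ge0.
- by rewrite lee_fin mulr_ge0// normal_pdf_ge0.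
rewrite (integral_lebn_prod G0 mG) -prodEFin.
rewrite EFinM muleAC -!muleA; congr (_ * (_ * _))%E.
apply: eq_bigr => j _.
rewrite /G -normal_prob_indic// fineK//.
exact: (finite_kernel_measure (star_ker j) x (mA (lift ord0 j))).
Qed.

Lemma integral_star_density : (\int[lebn R k.+1]_z (star_density u z)%:E = 1)%E.
Proof.
have := @integral_star_density_rect (fun=> setT) (fun=> measurableT).
have -> : rect_set (fun=> setT) = [set: k.+1.-tuple R] by apply/seteqP; split.
move=> ->; rewrite /star_prod.
under eq_integral => x _.
  rewrite big1; last by move=> j _; rewrite prob_kernel.
  over.
rewrite /= integral_cst// mul1e.
exact: (@probability_setT _ mR R (normal_prob (m 0 ord0) marg_sd)).
Qed.

End StarDensity.

(** * The density of N(m, S) *)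

Section GaussianDensity.
Context (R : realType) (k : nat) (m : 'rV[R]_k.+1) (S : 'M[R]_k.+1).
Hypothesis pS : posdef S.
Local Notation mR := (measurableTypeR R).
Local Notation leb := (@lebesgue_measure R).
Local Notation Q := (invmx S).

Lemma measurable_centered i : measurable_fun setT (fun z => centered m z 0 i).
Proof.
by under eq_fun do rewrite mxE; apply: measurable_funB => //; exact: measurable_tnth.
Qed.

Lemma measurable_quad_form_centered (M : 'M[R]_k.+1) :
  measurable_fun setT (fun z => quad_form (centered m z) M).
Proof.
rewrite (_ : (fun z => _) = fun z => \sum_j \sum_i
    (centered m z 0 i * M i j) * centered m z 0 j); last first.
  apply/funext => z; rewrite /quad_form mxE; apply: eq_bigr => j _.
  by rewrite mxE mulr_suml; apply: eq_bigr => i _; rewrite [_^T _ _]mxE.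
apply: measurable_sum => j; apply: measurable_sum => i.
apply: measurable_funM; last exact: measurable_centered.
by apply: measurable_funM => //; exact: measurable_centered.
Qed.

Lemma measurable_residual j : measurable_fun setT (fun z => residual S (centered m z) j).
Proof.
apply: measurable_funB; first exact: measurable_centered.
by apply: measurable_funM => //; exact: measurable_centered.
Qed.

Lemma residual_mstar (z : k.+1.-tuple R) j :
  residual S (centered m z) j = tnth z (lift ord0 j) - mstar m S j (tnth z ord0).
Proof. by rewrite /residual /cond_slope !mxE /mstar; ring. Qed.

Definition star_const : R := normal_peak (marg_sd S) * \prod_j normal_peak (star_sd S j).

Lemma star_const_gt0 : 0 < star_const.
Proof.
rewrite mulr_gt0 ?normal_peak_gt0 ?marg_sd_neq0//.
by rewrite prodr_gt0// => j _; rewrite normal_peak_gt0// star_sd_neq0.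
Qed.

Lemma star_densityE (u : 'I_k -> R -> R) z : star_density m S u z =
  star_const * expR (- ((centered m z 0 ord0 ^+ 2 / S ord0 ord0 +
    \sum_j Q (lift ord0 j) (lift ord0 j) *
      (residual S (centered m z) j - u j (tnth z ord0)) ^+ 2) / 2)).
Proof.
rewrite /star_density normal_pdfE ?marg_sd_neq0//.
under eq_bigr do rewrite normal_pdfE ?star_sd_neq0//.
rewrite big_split/= mulrACA -/star_const; congr (_ * _).
rewrite /normal_fun -expR_sum -expRD; congr expR.
rewrite mulrDl opprD mulr_suml -sumrN; congr (_ + _).
  rewrite sqr_sqrtr ?ltW ?posdef_diag_gt0// mxE -mulr_natl.
  by field; rewrite gt_eqF// posdef_diag_gt0.
apply: eq_bigr => j _.
have Qj := invmx_diag_gt0 pS (lift ord0 j).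
rewrite sqr_sqrtr ?invr_ge0 ?ltW// residual_mstar -mulr_natl.
by field; rewrite gt_eqF.
Qed.

Let energy (v : 'rV[R]_k.+1) := quad_form v Q / 2.

Let e z := expR (- energy (centered m z)).

Let me : measurable_fun setT e.
Proof.
apply: measurableT_comp => //; apply: measurable_funN.
by apply: measurable_funM => //; exact: measurable_quad_form_centered.
Qed.

Let e_lty : (\int[lebn R k.+1]_z (e z)%:E < +oo)%E.
Proof.
(* Averaging the d = k + 1 bounds v_i^2 / S_ii <= v Q v^T dominates the weight by a product of
   one-dimensional Gaussian weights of variances d S_ii. *)
pose s i := Num.sqrt (k.+1%:R * S i i).
have kS i : 0 < k.+1%:R * S i i by rewrite mulr_gt0// posdef_diag_gt0.
have s0 i : s i != 0 by rewrite gt_eqF// sqrtr_gt0.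
apply: (@le_lt_trans _ _ (\int[lebn R k.+1]_z
    \prod_i (normal_fun (m 0%R i) (s i) (tnth z i))%:E)%E).
  apply: ge0_le_integral => //.
  - by move=> z _; rewrite lee_fin expR_ge0.
  - exact/measurable_EFinP.
  - apply: emeasurable_prod => i; apply/measurable_EFinP.
    exact: (measurableT_comp (measurable_normal_fun _ _) (measurable_tnth (T := R) i)).
  - move=> z _; rewrite prodEFin lee_fin /normal_fun -expR_sum ler_expR.
    rewrite /energy.
    have -> : - (quad_form (centered m z) Q / 2) =
        \sum_(i < k.+1) - (quad_form (centered m z) Q / 2 / k.+1%:R).
      rewrite sumr_const card_ord -[RHS]mulr_natl mulrN; congr (- _).
      by rewrite [RHS]mulrC divfK// pnatr_eq0.
    apply: ler_sum => i _.
    have := quad_form_invmx_coord pS (centered m z) i.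
    rewrite sqr_sqrtr ?(ltW (kS i))// -[_ * S i i *+ 2]mulr_natl mxE mulNr lerN2 => h.
    have -> : (tnth z i - m 0 i) ^+ 2 / (2 * (k.+1%:R * S i i)) =
        (tnth z i - m 0 i) ^+ 2 / S i i / 2 / k.+1%:R.
      have N0 : k.+1%:R != 0 :> R by rewrite pnatr_eq0.
      have Sn : S i i != 0 by rewrite gt_eqF// posdef_diag_gt0.
      by move: (k.+1%:R : R) N0 => N N0; field; rewrite N0 Sn.
    by rewrite ler_pM2r ?invr_gt0// ler_pM2r.
rewrite (integral_lebn_prod (f := fun i y => (normal_fun (m 0%R i) (s i) y)%:E)); last 2 first.
- by move=> i y; rewrite lee_fin normal_fun_ge0.
- by move=> i; apply/measurable_EFinP; exact: measurable_normal_fun.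
have E i : (\int[leb]_y (normal_fun (m 0%R i) (s i) y)%:E = ((normal_peak (s i))^-1)%:E)%E.
  have pk := normal_peak_gt0 (s0 i).
  transitivity (\int[leb]_y (((normal_peak (s i))^-1)%:E * (normal_pdf (m 0%R i) (s i) y)%:E))%E.
    apply: eq_integral => y _; rewrite -EFinM normal_pdfE//.
    by rewrite mulKf// gt_eqF.
  rewrite ge0_integralZl//.
  - by rewrite integral_normal_pdf mule1.
  - by apply/measurable_EFinP; exact: measurable_normal_pdf.
  - by move=> y _; rewrite lee_fin normal_pdf_ge0.
  - by rewrite lee_fin invr_ge0 ltW.
by under eq_bigr do rewrite E; rewrite prodEFin ltry.
Qed.

(** Were the integral 0, the everywhere positive function [e] would vanish almost everywhere, so all
    integrals against [lebn] would be 0; but a star density integrates to 1. *)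
Let e_gt0 : (0 < \int[lebn R k.+1]_z (e z)%:E)%E.
Proof.
rewrite lt_neqAle eq_sym integral_ge0 ?andbT; last by move=> z _; rewrite lee_fin expR_ge0.
apply/eqP => e0.
have mE : measurable_fun setT (EFin \o e) by exact/measurable_EFinP.
have [+ _] := ae_eq_integral_abs (lebn R k.+1) measurableT mE.
have -> : (\int[lebn R k.+1]_x `|(EFin \o e) x| = 0)%E.
  by rewrite -[RHS]e0; apply: eq_integral => z _; rewrite gee0_abs// lee_fin expR_ge0.
move=> /(_ erefl) e_ae.
have mu0 (j : 'I_k) : measurable_fun setT (fun _ : R => 0 : R) by [].
have := integral_star_density m pS mu0.
rewrite (ae_eq_integral (cst 0%E))//.
- by rewrite integral0 => /eqP; rewrite eqe eq_sym oner_eq0.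
- by apply/measurable_EFinP; exact: measurable_star_density.
- apply: filterS e_ae => z /(_ I) /= [] /eqP.
  by rewrite expR_eq0.
Qed.

(** The normalising constant stays implicit as the inverse of a finite positive integral, with no
    determinant formula; it will enter only through K0. *)
Lemma gaussian_density (pi : probability (k.+1.-tuple R) R) : is_gaussian pi m S ->
  exists2 c : R, 0 < c & forall A, measurable A ->
    pi A = (\int[lebn R k.+1]_(z in A)
      (c * expR (- (quad_form (centered m z) Q / 2)))%:E)%E.
Proof.
move=> gpi.
have [Z ZE] : exists Z : R, (\int[lebn R k.+1]_z (e z)%:E = Z%:E)%E.
  exists (fine (\int[lebn R k.+1]_z (e z)%:E)); rewrite fineK// ge0_fin_numE//.
  exact: ltW e_gt0.
have Z0 : 0 < Z by rewrite -lte_fin -ZE.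
have d0 z : 0 <= Z^-1 * e z by rewrite mulr_ge0// ?invr_ge0 ?expR_ge0// ltW.
have md : measurable_fun setT (fun z => Z^-1 * e z) by exact: measurable_funM.
have d1 : (\int[lebn R k.+1]_z (Z^-1 * e z)%:E = 1)%E.
  under eq_integral do rewrite EFinM.
  rewrite ge0_integralZl//.
  - by rewrite ZE -EFinM mulVf// gt_eqF.
  - exact/measurable_EFinP.
  - by move=> z _; rewrite lee_fin expR_ge0.
  - by rewrite lee_fin invr_ge0 ltW.
have [P PE] := density_probability md d0 d1.
exists Z^-1; first by rewrite invr_gt0.
have gP : is_gaussian P m S.
  apply: (density_is_gaussian (q := energy) (c := Z^-1)).
  - by rewrite invr_ge0 ltW.
  - by apply: measurable_funM => //; exact: measurable_quad_form_centered.
  - by move=> A _; exact: PE.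
  - by move=> a v t; exact: quad_form_invmx_shift.
  - exact: pS.2.
move=> A mA; rewrite -PE; apply: cramer_wold mA => a B mB.
by rewrite gpi// gP.
Qed.

End GaussianDensity.

(** * Gibbs' variational inequality *)

Section Gibbs.
Context (R : realType) (n : nat) (mu pi : probability (n.-tuple R) R).
Local Notation T := (n.-tuple R).
Variable f : T -> R.
Hypothesis mf : measurable_fun setT f.

(** The Radon-Nikodym derivative is known [pi]-almost everywhere; domination carries this over to
    [mu], where the logarithm is integrated. *)
Lemma KL_density : (forall A, measurable A -> mu A = \int[pi]_(x in A) (expR (f x))%:E)%E ->
  KL mu pi = (\int[mu]_x (f x)%:E)%E.
Proof.
move=> muE.
have me : measurable_fun setT (fun x => (expR (f x))%:E).
  by apply/measurable_EFinP; exact: measurableT_comp.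
have dom : charge_of_finite_measure mu `<< pi.
  apply/null_content_dominatesP => A mA pA.
  change (mu A = 0)%E; rewrite muE//; apply: null_set_integral => //.
  exact: measurable_funTS.
rewrite /KL asboolT//.
set g := Radon_Nikodym _ _.
have ig : pi.-integrable setT g by exact: Radon_Nikodym_integrable.
have gf : ae_eq pi setT g (fun x => (expR (f x))%:E).
  apply: integral_ae_eq => // E _ mE.
  by rewrite -Radon_Nikodym_integral//; exact: muE.
have mg : measurable_fun setT g by exact: measurable_int ig.
apply: ae_eq_integral => //.
- apply/measurable_EFinP.
  exact: (measurableT_comp (@measurable_ln R) (measurableT_comp (fine_measurable measurableT) mg)).
- exact/measurable_EFinP.
- case: gf => N [mN N0 sN]; exists N; split => //.
    by move/null_content_dominatesP : dom; apply.
  move=> x /= nx; apply: sN => /= h; apply: nx => _; rewrite h//=.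
  by rewrite expRK.
Qed.

(** An inequality rather than an equality, so that truncated test functions qualify. *)
Hypothesis ef : (\int[pi]_x (expR (f x))%:E <= 1)%E.
Hypothesis intf : mu.-integrable setT (EFin \o f).

Section Dominated.
Hypothesis dom : charge_of_finite_measure mu `<< pi.

Let g (x : T) : R := fine (Radon_Nikodym (charge_of_finite_measure mu) pi x).

Let gE x : Radon_Nikodym (charge_of_finite_measure mu) pi x = (g x)%:E.
Proof. by rewrite fineK// Radon_Nikodym_fin_num. Qed.

Let mg : measurable_fun setT g.
Proof.
apply: (measurableT_comp (fine_measurable measurableT)).
exact: measurable_int (Radon_Nikodym_integrable dom).
Qed.

Let muE A : measurable A -> (mu A = \int[pi]_(x in A) (g x)%:E)%E.
Proof.
move=> mA; rewrite [LHS](Radon_Nikodym_integral dom mA).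
by apply: eq_integral => x _; rewrite gE.
Qed.

(** As a derivative of a charge, [g] carries no pointwise sign. [mu] gives no mass to the complement
    of [pos], so [g] may be replaced by the nonnegative [gp]. *)
Let pos := [set x | 0 < g x].

Let mpos : measurable pos.
Proof.
rewrite (_ : pos = setT `&` g @^-1` `]0, +oo[).
  by apply: mg => //; exact: measurable_itv.
by apply/seteqP; split => x /=; rewrite in_itv/= andbT => // -[].
Qed.

Let mu_npos : mu (~` pos) = 0%E.
Proof.
apply/eqP; rewrite eq_le measure_ge0 andbT muE; last exact: measurableC.
have g0 x : (~` pos) x -> (0 <= (- g x)%:E)%E.
  by move=> /negP; rewrite -leNgt => h; rewrite lee_fin oppr_ge0.
have -> : (\int[pi]_(x in ~` pos) (g x)%:E =
    - \int[pi]_(x in ~` pos) (- g x)%:E)%E.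
  by rewrite -integral_ge0N//; apply: eq_integral => x _; rewrite -EFinN opprK.
by rewrite oppe_le0 integral_ge0.
Qed.

Let gp x := if 0 < g x then g x else 0.

Let gp0 x : 0 <= gp x. Proof. by rewrite /gp; case: ifPn => // /ltW. Qed.

Let m_if (a b : T -> R) : measurable_fun setT a -> measurable_fun setT b ->
  measurable_fun setT (fun x => if 0 < g x then a x else b x).
Proof.
move=> ma mb; apply: measurable_fun_ifT => //.
by apply: (measurable_fun_ltr (f := cst 0)).
Qed.

Let mgp : measurable_fun setT gp. Proof. exact: m_if. Qed.

Let muEp A : measurable A -> (mu A = \int[pi]_(x in A) (gp x)%:E)%E.
Proof.
move=> mA.
have -> : mu A = mu (A `&` pos).
  rewrite -[in LHS](setUIDK A pos) measureU.
  - rewrite [X in (_ + X)%E](_ : _ = 0%E) ?adde0//.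
    apply/eqP; rewrite eq_le measure_ge0 andbT -mu_npos.
    apply: le_measure; rewrite ?inE; [exact: measurableD|exact: measurableC|].
    by move=> x [].
  - exact: measurableI.
  - exact: measurableD.
  - by rewrite setDE setIACA setICr setI0.
rewrite muE; last exact: measurableI.
rewrite [LHS]integral_mkcond [RHS]integral_mkcond; apply: eq_integral => x _.
rewrite !patchE in_setI /gp; case: (x \in A) => //=.
have -> : (x \in pos) = (0 < g x) by apply/idP/idP; rewrite inE.
by case: ifP.
Qed.

Let ge0_integral_mu (F : T -> \bar R) : (forall x, 0 <= F x)%E ->
  measurable_fun setT F -> (\int[mu]_x F x = \int[pi]_x (F x * (gp x)%:E))%E.
Proof. by move=> F0 mF; rewrite (ge0_integral_density mgp gp0 muEp). Qed.

(** On [pos], q = e^f / g, and L = ln g = f - ln q >= f + 1 - q = r, with equality only if L = f.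
    The default values make L = r = f off [pos]. Integrating against [mu], where q has mean at most
    1, gives Gibbs' inequality. *)
Let q x := if 0 < g x then expR (f x - ln (g x)) else 1.
Let L x := if 0 < g x then ln (g x) else f x.
Let r x := f x + 1 - q x.

Let mef : measurable_fun setT (fun x => expR (f x)).
Proof. exact: measurableT_comp. Qed.

Let mq : measurable_fun setT q.
Proof.
apply: m_if => //; apply: measurableT_comp => //; apply: measurable_funB => //.
exact: (measurableT_comp (@measurable_ln R)).
Qed.

Let mL : measurable_fun setT L.
Proof. by apply: m_if => //; exact: (measurableT_comp (@measurable_ln R)). Qed.

Let q0 x : 0 <= q x.
Proof. by rewrite /q; case: ifPn => // _; rewrite expR_ge0. Qed.

Let int_q_le1 : (\int[mu]_x (q x)%:E <= 1)%E.
Proof.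
rewrite ge0_integral_mu; last 2 first.
- by move=> x; rewrite lee_fin.
- exact/measurable_EFinP.
apply: le_trans ef; apply: ge0_le_integral => //.
- by move=> x _; rewrite mule_ge0// lee_fin.
- by apply: emeasurable_funM; exact/measurable_EFinP.
- exact/measurable_EFinP.
- move=> x _; rewrite -EFinM lee_fin /q /gp; case: ifPn => g0.
    by rewrite expRD expRN lnK// divfK// gt_eqF.
  by rewrite mulr0 expR_ge0.
Qed.

Let integrable_q : mu.-integrable setT (EFin \o q).
Proof.
apply/integrableP; split; first exact/measurable_EFinP.
under eq_integral do rewrite gee0_abs ?lee_fin//.
by rewrite (le_lt_trans int_q_le1)// ltry.
Qed.

Let integrable_cst1 : mu.-integrable setT (EFin \o cst (1:R)).
Proof. by apply: bounded_mfun_integrable; exact: bounded_mfun_cst. Qed.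

Let integrable_r : mu.-integrable setT (EFin \o r).
Proof.
rewrite (_ : (EFin \o r = ((EFin \o f) \+ (EFin \o cst (1%R : R))) \- (EFin \o q))%E).
  by apply: integrableB => //; exact: integrableD.
by apply/funext => x.
Qed.

Let int_r_ge : (\int[mu]_x (f x)%:E <= \int[mu]_x (r x)%:E)%E.
Proof.
have -> : (\int[mu]_x (r x)%:E = \int[mu]_x (f x)%:E + 1 - \int[mu]_x (q x)%:E)%E.
  transitivity (\int[mu]_x (((EFin \o f) \+ (EFin \o cst (1%R : R))) x - (q x)%:E))%E.
    by apply: eq_integral => x _.
  rewrite integralB//; last exact: integrableD.
  have E1 : (\int[mu]_x (EFin \o cst (1%R : R)) x = 1)%E.
    transitivity (\int[mu]_x cst 1%E x)%E; first by [].
    by rewrite integral_cst// mul1e; exact: probability_setT.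
  by rewrite integralD// E1.
have [Z ZE] : exists Z, (\int[mu]_x (q x)%:E = Z%:E)%E.
  by exists (fine (\int[mu]_x (q x)%:E)); rewrite fineK//; exact: integrable_fin_num.
rewrite ZE -addeA leeDl// -EFinB lee_fin subr_ge0 -lee_fin -ZE.
exact: int_q_le1.
Qed.

Let L_ge_r x : r x <= L x ?= iff (L x == f x).
Proof.
rewrite /L /r /q; case: ifPn => g0; last by rewrite addrK eqxx; split; rewrite ?eqxx.
split; first by have := expR_ge1Dx (f x - ln (g x)); lra.
have [->|ne] := eqVneq (ln (g x)) (f x); first by rewrite subrr expR0 addrK eqxx.
have : f x - ln (g x) != 0 by rewrite subr_eq0 eq_sym.
by move=> /expR_gt1Dx h; apply/eqP; lra.
Qed.

Let KLE : KL mu pi = (\int[mu]_x (L x)%:E)%E.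
Proof.
rewrite /KL asboolT//; apply: ae_eq_integral => //.
- apply/measurable_EFinP; exact: (measurableT_comp (@measurable_ln R) mg).
- exact/measurable_EFinP.
- exists (~` pos); split => //; first exact: measurableC.
  by move=> x /= nx xpos; apply: nx => _; rewrite /L xpos.
Qed.

Let D x := L x - r x.
Let D0 x : 0 <= D x. Proof. by rewrite subr_ge0 L_ge_r. Qed.
Let mr : measurable_fun setT r.
Proof. by apply: measurable_funB => //; exact: measurable_funD. Qed.
Let mD : measurable_fun setT D. Proof. exact: measurable_funB. Qed.

(** As L >= r with r integrable, the negative part of L is integrable. So either L is integrable and
    integrals add, or the integral of L is +oo. *)
Let KL_dichotomy : KL mu pi = +oo%E \/
  KL mu pi = (\int[mu]_x (r x)%:E + \int[mu]_x (D x)%:E)%E.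
Proof.
rewrite KLE; have [iL|] := pselect (mu.-integrable setT (EFin \o L)).
  right; rewrite -integralD//; last first.
    rewrite (_ : (fun x => (D x)%:E) = ((EFin \o L) \- (EFin \o r))%E); last exact/funext.
    exact: integrableB.
  by apply: eq_integral => x _; rewrite -EFinD /D addrC subrK.
move=> niL; left.
have Lneg : (\int[mu]_x (EFin \o L)^\- x < +oo)%E.
  apply: (@le_lt_trans _ _ (\int[mu]_x (EFin \o r)^\- x)%E).
    apply: ge0_le_integral => //.
    - by apply: measurable_funeneg; exact/measurable_EFinP.
    - by apply: measurable_funeneg; exact/measurable_EFinP.
    - move=> x _; rewrite !funenegE/=.
      by rewrite ge_max le_max lee_fin lerN2 L_ge_r/= le_max lexx orbT.
  have := integrable_funeneg measurableT integrable_r.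
  move=> /integrableP[_]; under eq_integral do rewrite gee0_abs//; exact.
rewrite integralE.
have -> : (\int[mu]_x (EFin \o L)^\+ x = +oo)%E.
  apply: contrapT => /eqP; rewrite -ltey => Lpos; apply: niL.
  apply/integrableP; split; first exact/measurable_EFinP.
  rewrite (eq_integral (fun x => (EFin \o L)^\+ x + (EFin \o L)^\- x)%E); last first.
    by move=> x _; rewrite -/((abse \o (EFin \o L)) x) fune_abse.
  rewrite ge0_integralD//.
  - by rewrite lte_add_pinfty.
  - by apply: measurable_funepos; exact/measurable_EFinP.
  - by apply: measurable_funeneg; exact/measurable_EFinP.
rewrite addye//; move: Lneg; rewrite ltey; apply: contra => /eqP h.
by rewrite -[X in X == _]oppeK h.
Qed.

Lemma gibbs_dominated : (\int[mu]_x (f x)%:E <= KL mu pi)%E.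
Proof.
case: KL_dichotomy => ->; first exact: leey.
by rewrite (le_trans int_r_ge)// leeDl// integral_ge0// => x _; rewrite lee_fin.
Qed.

(** Equality forces D = L - r to have mean 0, so g = e^f holds [mu]-almost everywhere. On a
    [mu]-null set [pi] may still give mass to e^f, hence only an inequality. *)
Lemma gibbs_eq_dominated : KL mu pi = (\int[mu]_x (f x)%:E)%E ->
  forall A, measurable A -> (mu A <= \int[pi]_(x in A) (expR (f x))%:E)%E.
Proof.
move=> KLf.
have ff : (\int[mu]_x (f x)%:E)%E \is a fin_num by exact: integrable_fin_num.
have rf : (\int[mu]_x (r x)%:E)%E \is a fin_num by exact: integrable_fin_num.
have intD : (\int[mu]_x (D x)%:E = 0)%E.
  case: KL_dichotomy; rewrite KLf => h; first by move: ff; rewrite h.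
  apply/eqP; rewrite eq_le integral_ge0 ?andbT; last by move=> x _; rewrite lee_fin.
  by rewrite -(leeD2lE _ _ rf) adde0 -h.
have mE : measurable_fun setT (EFin \o D) by exact/measurable_EFinP.
have [+ _] := ae_eq_integral_abs mu measurableT mE.
under eq_integral do rewrite gee0_abs ?lee_fin//.
move=> /(_ intD)[N [mN N0 sN]].
pose E := pos `&` ~` N.
have mEs : measurable E by apply: measurableI => //; exact: measurableC.
have muEC : mu (~` E) = 0%E.
  apply/eqP; rewrite eq_le measure_ge0 andbT.
  rewrite /E setCI setCK.
  have -> : (0 = mu (~` pos) + mu N)%E by rewrite mu_npos N0 adde0.
  by apply: measureU2 => //; exact: measurableC.
move=> A mA.
apply: (@le_trans _ _ (mu (A `&` E) + mu (A `\` E))%E).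
  rewrite -[in leLHS](setUIDK A E) measureU//; [exact: measurableI|exact: measurableD|].
  by rewrite setDE setIACA setICr setI0.
have -> : mu (A `\` E) = 0%E.
  apply/eqP; rewrite eq_le measure_ge0 andbT -muEC.
  apply: le_measure; rewrite ?inE; [exact: measurableD|exact: measurableC|].
  by move=> x [].
rewrite adde0 muEp; last exact: measurableI.
rewrite [leLHS]integral_mkcond [leRHS]integral_mkcond.
apply: ge0_le_integral => //.
- by move=> x _; apply: erestrict_ge0 => y _; rewrite lee_fin.
- apply/(measurable_restrictT _ _).1; first exact: measurableI.
  by apply: measurable_funTS; exact/measurable_EFinP.
- apply/(measurable_restrictT _ _).1 => //.
  by apply: measurable_funTS; exact/measurable_EFinP.
move=> x _; rewrite !patchE in_setI; case: (x \in A) => //=.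
case: ifPn => [|_]; last by rewrite lee_fin expR_ge0.
rewrite inE => -[xpos nNx]; rewrite lee_fin /gp xpos.
have /eqP : D x = 0.
  apply: contrapT => Dx; apply: nNx; apply: sN => /= h; apply: Dx.
  by have [] := h I.
rewrite subr_eq0 eq_sym (L_ge_r x).2 /L xpos => /eqP <-.
by rewrite lnK.
Qed.

End Dominated.

Lemma gibbs : (\int[mu]_x (f x)%:E <= KL mu pi)%E.
Proof.
have [dom|ndom] := pselect (charge_of_finite_measure mu `<< pi).
  exact: gibbs_dominated.
by rewrite /KL asboolF// leey.
Qed.

Lemma gibbs_eq : KL mu pi = (\int[mu]_x (f x)%:E)%E ->
  forall A, measurable A -> (mu A <= \int[pi]_(x in A) (expR (f x))%:E)%E.
Proof.
have [dom|ndom] := pselect (charge_of_finite_measure mu `<< pi).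
  exact: gibbs_eq_dominated.
rewrite /KL asboolF// => h.
by have := integrable_fin_num measurableT intf; rewrite -h.
Qed.

End Gibbs.

(** * Moments *)

Section Moments.
Context d (T : measurableType d) (R : realType) (P : probability T R).
Implicit Types (f g : T -> R) (c : R).

(** Integrability travels with the value, so that means of linear combinations can be composed
    without side conditions. *)
Definition has_mean f c :=
  P.-integrable setT (EFin \o f) /\ (\int[P]_x (f x)%:E = c%:E)%E.

Lemma has_mean_cst c : has_mean (fun=> c) c.
Proof.
split; first by apply: bounded_mfun_integrable; exact: bounded_mfun_cst.
transitivity (\int[P]_x cst c%:E x)%E; first by [].
rewrite integral_cst// [X in (_ * X)%E](_ : _ = 1%E) ?mule1//.
exact: probability_setT.
Qed.

Lemma has_meanD f g a b : has_mean f a -> has_mean g b ->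
  has_mean (fun x => f x + g x) (a + b).
Proof.
move=> [fi fa] [gi gb]; split.
  have := integrableD measurableT fi gi.
  by congr (integrable _ _ _); apply/funext.
by under eq_integral do rewrite EFinD; rewrite integralD// fa gb.
Qed.

Lemma has_meanZ c f a : has_mean f a -> has_mean (fun x => c * f x) (c * a).
Proof.
move=> [fi fa]; split.
  have := integrableZl measurableT c fi.
  by congr (integrable _ _ _); apply/funext.
by under eq_integral do rewrite EFinM; rewrite integralZl// fa.
Qed.

Lemma has_mean_sum (I : Type) (s : seq I) (f : I -> T -> R) (a : I -> R) :
  (forall i, has_mean (f i) (a i)) ->
  has_mean (fun x => \sum_(i <- s) f i x) (\sum_(i <- s) a i).
Proof.
move=> h; elim: s => [|i s IH].
  by rewrite big_nil; under eq_fun do rewrite big_nil; exact: has_mean_cst.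
by rewrite big_cons; under eq_fun do rewrite big_cons; exact: has_meanD.
Qed.

Lemma has_mean_integrable f : P.-integrable setT (EFin \o f) ->
  has_mean f (fine (\int[P]_x (f x)%:E)).
Proof. by move=> fi; split=> //; rewrite fineK//; exact: integrable_fin_num. Qed.

Lemma has_mean_uniq f a b : has_mean f a -> has_mean f b -> a = b.
Proof. by move=> [_ fa] [_]; rewrite fa => -[]. Qed.

Lemma has_mean_ge0 f a : (forall x, 0 <= f x) -> has_mean f a -> 0 <= a.
Proof. by move=> f0 [_ fa]; rewrite -lee_fin -fa integral_ge0// => x _; rewrite lee_fin. Qed.

Definition square_integrable f :=
  measurable_fun setT f /\ P.-integrable setT (EFin \o (fun x => f x ^+ 2)).

Lemma square_integrable_ltyP f : measurable_fun setT f ->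
  (\int[P]_x (f x ^+ 2)%:E < +oo)%E -> square_integrable f.
Proof.
move=> mf flty; split => //; apply/integrableP; split.
  by apply/measurable_EFinP; exact: measurable_funX.
by under eq_integral do rewrite gee0_abs ?lee_fin ?sqr_ge0//.
Qed.

Lemma square_integrable_cst c : square_integrable (fun=> c).
Proof. by split => //; have [] := has_mean_cst (c ^+ 2). Qed.

Lemma square_integrableM f g : square_integrable f -> square_integrable g ->
  P.-integrable setT (EFin \o (fun x => f x * g x)).
Proof.
move=> [mf fi] [mg gi]; have := integrableD measurableT fi gi.
apply: le_integrable => //; first by apply/measurable_EFinP; exact: measurable_funM.
move=> x _ /=; rewrite lee_fin.
rewrite [leRHS]ger0_norm ?addr_ge0 ?sqr_ge0// normrM.
rewrite -[f x ^+ 2]real_normK ?num_real// -[g x ^+ 2]real_normK ?num_real//.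
have := sqr_ge0 (`|f x| - `|g x|); rewrite sqrrB.
have : 0 <= `|f x| * `|g x| by rewrite mulr_ge0.
by rewrite -mulr_natl; lra.
Qed.

Lemma square_integrableW f : square_integrable f -> P.-integrable setT (EFin \o f).
Proof.
move=> fs; have := square_integrableM fs (square_integrable_cst 1).
by under [in X in X -> _]eq_fun do rewrite mulr1.
Qed.

Lemma square_integrableZ c f : square_integrable f -> square_integrable (fun x => c * f x).
Proof.
move=> [mf fi]; split; first exact: measurable_funM.
have [] := has_meanZ (c ^+ 2) (has_mean_integrable fi).
by under [in X in X -> _]eq_fun do rewrite -exprMn.
Qed.

Lemma square_integrableD f g : square_integrable f -> square_integrable g ->
  square_integrable (fun x => f x + g x).
Proof.
move=> fs gs; have [mf fi] := fs; have [mg gi] := gs.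
split; first exact: measurable_funD.
have h := has_meanD (has_meanD (has_mean_integrable fi) (has_mean_integrable gi))
  (has_meanZ 2 (has_mean_integrable (square_integrableM fs gs))).
case: h => + _; congr (integrable _ _ _); apply/funext => x /=; congr EFin.
by ring.
Qed.

(* Jensen's inequality; the mean is the junk value 0 when [f] is not integrable. *)
Lemma sqr_mean_le f : measurable_fun setT f ->
  ((fine (\int[P]_x (f x)%:E) ^+ 2)%:E <= \int[P]_x (f x ^+ 2)%:E)%E.
Proof.
move=> mf; have [flty|] := boolP (\int[P]_x (f x ^+ 2)%:E < +oo)%E; last first.
  by rewrite -leNgt leye_eq => /eqP ->; rewrite leey.
have fs := square_integrable_ltyP mf flty.
have h1 := has_mean_integrable (square_integrableW fs).
have h2 := has_mean_integrable fs.2.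
set u := fine _ in h1 *.
have h := has_meanD (has_meanD h2 (has_meanZ (- 2 * u) h1)) (has_mean_cst (u ^+ 2)).
rewrite h2.2 lee_fin -subr_ge0.
set b := fine _ in h2 h *.
have -> : b - u ^+ 2 = b + - 2 * u * u + u ^+ 2 by ring.
apply: has_mean_ge0 h => x.
have -> : f x ^+ 2 + - 2 * u * f x + u ^+ 2 = (f x - u) ^+ 2 by ring.
exact: sqr_ge0.
Qed.

End Moments.

(** * Measures with the star structure *)

Section RectangleUniqueness.
Context (R : realType) (n : nat).

Lemma measure_rect_unique (m1 m2 : {measure set (n.-tuple R) -> \bar R}) :
  (forall A : 'I_n -> set R, (forall i, measurable (A i)) ->
     m1 (rect_set A) = m2 (rect_set A)) ->
  (m1 setT < +oo)%E -> forall U, measurable U -> m1 U = m2 U.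
Proof.
move=> m12 m1T.
pose G := [set rect_set A | A in [set A : 'I_n -> set R | forall i, measurable (A i)]].
have GT : G setT.
  by exists (fun=> setT) => //; apply/seteqP; split.
apply: (measure_unique G (fun=> setT)) => //.
- apply/seteqP; split.
    apply: smallest_sub; first exact: smallest_sigma_algebra.
    move=> B; rewrite -bigcup_seq => -[i _ [C mC <-]]; apply: sub_sigma_algebra.
    exists (fun j => if j == i then C else setT).
      by move=> j /=; case: eqP.
    apply/seteqP; split => z /=.
      by move=> /(_ i); rewrite eqxx; split.
    by move=> [_ zC] j; case: eqP => [->|].
  apply: smallest_sub; first exact: sigma_algebra_measurable.
  by move=> _ [A mA <-]; exact: measurable_rect_set.
- move=> _ _ [A mA <-] [B mB <-]; exists (fun i => A i `&` B i).
    by move=> i; exact: measurableI.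
  by apply/seteqP; split => z /= h; [split=> i; have [] := h i|move=> i; have [h1 h2] := h; split].
- by apply/seteqP; split => // z _; exists 0%N.
- by move=> _ [A mA <-]; exact: m12.
Qed.

End RectangleUniqueness.

Section StarRepresentation.
Context (R : realType) (k : nat).
Local Notation mR := (measurableTypeR R).
Variables (mu : probability (k.+1.-tuple R) R) (mu1 : probability mR R).
Variable K : 'I_k -> R.-pker mR ~> mR.

Definition cond_law : R.-sfker mR ~> k.-tuple R :=
  prodk (fun j => K j : R.-sfker mR ~> mR).

Lemma cond_law_rect x (A : 'I_k -> set R) : (forall i, measurable (A i)) ->
  cond_law x (rect_set A) = (\prod_(j < k) K j x (A j))%E.
Proof.
move=> mA; have mr := measurable_rect_set mA.
have -> : cond_law x (rect_set A) = (\int[cond_law x]_t (\1_(rect_set A) t)%:E)%E.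
  by rewrite integral_indic// setIT.
under eq_integral do rewrite indic_rect_set -prodEFin.
rewrite (@integral_prodk_prod _ _ _ _ _ _ (fun j y => (\1_(A j) y)%:E)).
- by apply: eq_bigr => j _; rewrite integral_indic// ?setIT//; exact: mA.
- by move=> j y; rewrite lee_fin.
- by move=> j; apply/measurable_EFinP; exact: (@measurable_indic _ mR R setT _ (mA j)).
Qed.

Lemma cond_lawT x : cond_law x setT = 1%E.
Proof.
have -> : [set: k.-tuple R] = rect_set (fun=> setT) by apply/seteqP; split.
by rewrite cond_law_rect// big1// => j _; exact: prob_kernel.
Qed.

(** Draw the head from [mu1], then the tail from [cond_law]. Agreement with [mu] on rectangles turns
    the definition of [C_star] into an iterated-integral formula. *)
Let joint_law : {measure set (k.+1.-tuple R) -> \bar R} :=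
  (mkcomp (@kconst _ _ unit mR R mu1)
    (mkcomp (kpre (@measurable_snd _ _ unit mR) cond_law)
       (kdirac (@measurable_cons_tuple R _ unit k))
      : R.-sfker (unit * mR) ~> k.+1.-tuple R)) tt.

Let integral_joint_law (F : k.+1.-tuple R -> \bar R) :
  (forall z, 0 <= F z)%E -> measurable_fun setT F ->
  (\int[joint_law]_z F z =
   \int[mu1]_x \int[cond_law x]_t F [the k.+1.-tuple R of x :: t])%E.
Proof.
move=> F0 mF; rewrite [LHS]integral_kcomp//.
apply: eq_integral => x _.
rewrite integral_kcomp//; apply: eq_integral => t _.
by rewrite integral_dirac// diracT mul1e.
Qed.

Hypothesis muE : forall A : 'I_k.+1 -> set R, (forall i, measurable (A i)) ->
  mu (rect_set A) = star_prod mu1 (fun j x => K j x) A.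

Let mu_joint U : measurable U -> mu U = joint_law U.
Proof.
apply: measure_rect_unique; last by rewrite (le_lt_trans (probability_le1 _ _))// ltry.
move=> A mA; have mr := measurable_rect_set mA.
transitivity (star_prod mu1 (fun j x => K j x) A); first exact: muE.
have -> : joint_law (rect_set A) = (\int[joint_law]_z (\1_(rect_set A) z)%:E)%E.
  by rewrite integral_indic// setIT.
rewrite integral_joint_law; last 2 first.
- by move=> z; rewrite lee_fin.
- by apply/measurable_EFinP; exact: measurable_indic.
rewrite /star_prod [LHS]integral_mkcond; apply: eq_integral => x _.
transitivity (\int[cond_law x]_t ((\1_(A ord0) x)%:E *
    (\1_(rect_set (fun j => A (lift ord0 j))) t)%:E))%E; last first.
  apply: eq_integral => t _.
  rewrite !indic_rect_set big_ord_recl EFinM; congr (_ * _%:E)%E.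
  by apply: eq_bigr => j _; rewrite tnthS.
have mr' := measurable_rect_set (fun j => mA (lift ord0 j)).
rewrite ge0_integralZl//; last by apply/measurable_EFinP; exact: measurable_indic.
rewrite integral_indic// setIT cond_law_rect// epatch_indic muleC; congr (_ * _)%E.
rewrite -prodEFin; apply: eq_bigr => j _; rewrite fineK//.
exact: (finite_kernel_measure (K j) x (mA (lift ord0 j))).
Qed.

Lemma ge0_integral_star (F : k.+1.-tuple R -> \bar R) :
  (forall z, 0 <= F z)%E -> measurable_fun setT F ->
  (\int[mu]_z F z =
   \int[mu1]_x \int[cond_law x]_t F [the k.+1.-tuple R of x :: t])%E.
Proof.
move=> F0 mF; rewrite -integral_joint_law//.
by apply: eq_measure_integral => A mA _; exact: mu_joint.
Qed.

Lemma measurable_integral_cond_law (F : k.+1.-tuple R -> \bar R) :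
  (forall z, 0 <= F z)%E -> measurable_fun setT F ->
  measurable_fun setT (fun x => \int[cond_law x]_t F [the k.+1.-tuple R of x :: t])%E.
Proof.
move=> F0 mF.
apply: (@measurable_integral_prodk R _ mR k (fun j => K j : R.-sfker mR ~> mR)
  (fun p : mR * k.-tuple R => F [the k.+1.-tuple R of p.1 :: p.2])) => //.
exact: (measurableT_comp mF (@measurable_pair_cons R k)).
Qed.

(** The inner integral is by definition a difference of positive and negative parts, even where it
    is infinite. Integrability of [F] makes both outer integrals finite, so the nonnegative case
    applies to each. *)
Lemma integral_star (F : k.+1.-tuple R -> \bar R) : mu.-integrable setT F ->
  measurable_fun setT (fun x => \int[cond_law x]_t F [the k.+1.-tuple R of x :: t])%E /\
  (\int[mu]_z F z =
   \int[mu1]_x \int[cond_law x]_t F [the k.+1.-tuple R of x :: t])%E.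
Proof.
move=> iF; have mF := measurable_int mu iF.
have mp := measurable_integral_cond_law (fun z => funepos_ge0 F z) (measurable_funepos mF).
have mn := measurable_integral_cond_law (fun z => funeneg_ge0 F z) (measurable_funeneg mF).
have E : (fun x => \int[cond_law x]_t F [the k.+1.-tuple R of x :: t])%E =
    (fun x => \int[cond_law x]_t F^\+ [the k.+1.-tuple R of x :: t] -
     \int[cond_law x]_t F^\- [the k.+1.-tuple R of x :: t])%E.
  by apply/funext => x; rewrite integralE; congr (_ - _)%E;
    apply: eq_integral => t _; rewrite ?funeposE ?funenegE.
split; first by rewrite E; exact: emeasurable_funB.
rewrite E integralB//; last 2 first.
- apply/integrableP; split => //.
  under eq_integral do rewrite gee0_abs ?integral_ge0//.
  rewrite -ge0_integral_star//; last exact: measurable_funepos.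
  have /integrableP[_] := integrable_funepos measurableT iF.
  by under eq_integral do rewrite gee0_abs//.
- apply/integrableP; split => //.
  under eq_integral do rewrite gee0_abs ?integral_ge0//.
  rewrite -ge0_integral_star//; last exact: measurable_funeneg.
  have /integrableP[_] := integrable_funeneg measurableT iF.
  by under eq_integral do rewrite gee0_abs//.
rewrite [LHS]integralE -!ge0_integral_star//.
- exact: measurable_funeneg.
- exact: measurable_funepos.
Qed.

End StarRepresentation.

(** * Means of quadratic functions of independent coordinates *)

Section Independence.

Lemma has_mean_pushforward d d' (T : measurableType d) (T' : measurableType d')
    (R : realType) (P : probability T R) (P' : probability T' R) (phi : T -> T')
    (F : T' -> R) a :
  measurable_fun setT phi -> (forall A, measurable A -> P (phi @^-1` A) = P' A) ->
  has_mean P' F a -> has_mean P (F \o phi) a.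
Proof.
move=> mphi PP' [iF Fa].
have mF : measurable_fun setT (EFin \o F) := measurable_int P' iF.
have iFphi : P.-integrable setT ((EFin \o F) \o phi).
  apply/integrableP; split; first exact: measurableT_comp.
  have mabs : measurable_fun setT (abse \o (EFin \o F)) by exact: measurableT_comp.
  have := @ge0_integral_pushforward _ _ _ _ R _ mphi P setT (abse \o (EFin \o F))
    measurableT mabs (fun y _ => abse_ge0 _).
  rewrite preimage_setT /= => <-.
  rewrite (eq_measure_integral P'); last by move=> A mA _; exact: PP'.
  by move/integrableP : iF => [].
split; first exact: iFphi.
have := integral_pushforward mphi mF (D := setT) iFphi measurableT.
rewrite preimage_setT => <-; rewrite -Fa.
by apply: eq_measure_integral => A mA _; exact: PP'.
Qed.

Context (R : realType) (k : nat).
Local Notation mR := (measurableTypeR R).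
Variables (P : probability (k.-tuple R) R) (P_ : 'I_k -> probability mR R).
Hypothesis PE : forall A : 'I_k -> set R, (forall i, measurable (A i)) ->
  P (rect_set A) = (\prod_j P_ j (A j))%E.

Let measurable_coord i : measurable_fun setT (fun t : k.-tuple R => tnth t i : mR).
Proof. exact: (measurable_tnth (T := R) i). Qed.

Lemma has_mean_coord i (F : mR -> R) a : has_mean (P_ i) F a ->
  has_mean P (fun t => F (tnth t i)) a.
Proof.
apply: (has_mean_pushforward (@measurable_coord i)) => A mA.
pose B j := if j == i then A else setT.
have mB j : measurable (B j : set R) by rewrite /B; case: eqP.
have -> : (fun t : k.-tuple R => tnth t i : mR) @^-1` A = rect_set B.
  apply/seteqP; split => t /=; first by move=> tA j; rewrite /B; case: eqP => [->|].
  by move=> /(_ i); rewrite /B eqxx.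
rewrite PE// (bigD1 i)//= /B eqxx big1 ?mule1// => j ji.
by rewrite (negbTE ji); exact: probability_setT.
Qed.

(** The pair of coordinates i, j has the product law of [P_ i] and [P_ j], checked on rectangles;
    Fubini then factors the mean. *)
Lemma has_mean_coord2 i j (F G : mR -> R) a b : i != j ->
  measurable_fun setT F -> measurable_fun setT G ->
  has_mean (P_ i) F a -> has_mean (P_ j) G b ->
  has_mean P (fun t => F (tnth t i) * G (tnth t j)) (a * b).
Proof.
move=> ij mF mG [iF Fa] [iG Gb].
pose phi (t : k.-tuple R) : mR * mR := (tnth t i, tnth t j).
have mphi : measurable_fun setT phi by apply: measurable_fun_pair.
have m1 : measurable_fun setT (fun p : mR * mR => F p.1).
  exact: (measurableT_comp mF (@measurable_fst _ _ mR mR)).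
have m2 : measurable_fun setT (fun p : mR * mR => G p.2).
  exact: (measurableT_comp mG (@measurable_snd _ _ mR mR)).
pose H (p : mR * mR) := F p.1 * G p.2.
have mH : measurable_fun setT (EFin \o H).
  by apply/measurable_EFinP; exact: measurable_funM.
pose P2 : probability (mR * mR)%type R := (P_ i \x P_ j)%E.
have iH : P2.-integrable setT (EFin \o H).
  apply/(integrable12ltyP (P_ i) (P_ j) mH).
  rewrite (eq_integral (fun x => `|(F x)%:E| * \int[P_ j]_y `|(G y)%:E|)%E); last first.
    move=> x _; rewrite -ge0_integralZl//.
    - by apply: eq_integral => y _; rewrite /= normrM EFinM.
    - by apply: measurableT_comp => //; exact/measurable_EFinP.
  rewrite ge0_integralZr//.
  - apply: lte_mul_pinfty; first exact: integral_ge0.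
      by apply: integrable_fin_num => //; exact: integrable_abse.
    by case/integrableP: iG.
  - by apply: measurableT_comp => //; exact/measurable_EFinP.
  - exact: integral_ge0.
apply: (has_mean_pushforward (P' := P2) (F := H) mphi).
  move=> D mD; suff : (P_ i \x P_ j)%E D = pushforward P phi D by move/esym.
  apply: product_measure_unique => //.
  move=> A1 A2 mA1 mA2.
  pose B l := if l == i then A1 else if l == j then A2 else setT.
  have mB l : measurable (B l : set R) by rewrite /B; case: eqP => // _; case: eqP.
  have e : phi @^-1` (A1 `*` A2) = rect_set B.
    apply/seteqP; split => t /=.
      by move=> [tA tB] l; rewrite /B; case: eqP => [->//|_]; case: eqP => [->|].
    move=> h; split; have := h i; have := h j; rewrite /B !eqxx//.
    by rewrite eq_sym (negbTE ij).
  transitivity (P (rect_set B)); first by rewrite -e.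
  rewrite PE// (bigD1 i)//= (bigD1 j)//= 1?eq_sym// /B !eqxx eq_sym (negbTE ij).
  rewrite big1 ?mule1// => l /andP[li lj].
  by rewrite (negbTE li) (negbTE lj); exact: probability_setT.
split => //.
transitivity (\int[P_ i]_x fubini_F (P_ j) (EFin \o H) x)%E.
  by apply/esym; exact: integral12_prod_meas1.
rewrite (eq_integral (fun x => b%:E * (F x)%:E)%E); last first.
  move=> x _; rewrite /fubini_F/= -Gb muleC -integralZl//.
rewrite integralZl// Fa -EFinM; congr EFin; ring.
Qed.

(** On the diagonal w^2 - (w - u)^2 = 2 u w - u^2 is affine in w and has mean u^2; off the diagonal
    independence gives u_i u_j. Second moments therefore disappear from the value. [psi] is the
    integrand after this cancellation. *)
Lemma has_mean_quadratic (A : 'I_k -> 'I_k -> R) (c u : 'I_k -> R) (K0 : R) :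
  (forall j, square_integrable (P_ j) (fun y => y - c j)) ->
  (forall j, u j = fine (\int[P_ j]_y (y - c j)%:E)%E) ->
  has_mean P (fun t => K0 + (\sum_i \sum_j A i j * ((tnth t i - c i) * (tnth t j - c j)) -
      \sum_j A j j * (tnth t j - c j - u j) ^+ 2) / 2)
    (K0 + (\sum_i \sum_j A i j * (u i * u j)) / 2).
Proof.
move=> sq uE.
have mean1 j : has_mean (P_ j) (fun y => y - c j) (u j).
  by rewrite uE; exact/has_mean_integrable/square_integrableW.
have mw j : measurable_fun setT (fun y : mR => y - c j) by case: (sq j).
pose psi i j (t : k.-tuple R) := if i == j then 2 * u j * (tnth t j - c j) + - u j ^+ 2
  else (tnth t i - c i) * (tnth t j - c j).
have mean2 i j : has_mean P (psi i j) (u i * u j).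
  rewrite /psi; case: eqP => [->|/eqP ij].
    have -> : u j * u j = 2 * u j * u j + - u j ^+ 2 by ring.
    apply: has_meanD; last exact: has_mean_cst.
    by apply: has_meanZ; exact: (has_mean_coord (F := fun y => y - c j)).
  exact: (has_mean_coord2 (F := fun y => y - c i) (G := fun y => y - c j)).
have := has_meanD (has_mean_cst P K0) (has_meanZ 2^-1 (has_mean_sum (index_enum 'I_k)
  (fun i => has_mean_sum (index_enum 'I_k) (fun j => has_meanZ (A i j) (mean2 i j))))).
rewrite (mulrC 2^-1); congr has_mean; apply/funext => t.
rewrite [2^-1 * _]mulrC; congr (_ + _ / 2).
rewrite -sumrB; apply: eq_bigr => i _.
rewrite (bigD1 i)//= [in RHS](bigD1 i)//= /psi eqxx addrAC; congr (_ + _).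
  by ring.
by apply: eq_bigr => j ji; rewrite eq_sym (negbTE ji).
Qed.

End Independence.

(** * Moments of Gaussian measures *)

Section NormalMoments.
Context (R : realType).
Local Notation mR := (measurableTypeR R).
Local Notation leb := (@lebesgue_measure R).

(** Proved as for translations, except that a reflection swaps the closed and open ends of the
    interval. It yields the Gaussian mean by symmetry. *)
Lemma ge0_integral_lebesgue_reflect (c : R) (f : mR -> \bar R) :
  (forall x, 0 <= f x)%E -> measurable_fun setT f ->
  (\int[leb]_x f (c - x)%R = \int[leb]_x f x)%E.
Proof.
move=> f0 mf.
have ms : measurable_fun [set: mR] (fun x : mR => (c - x)%R : mR).
  by have := measurable_funB (@measurable_cst _ _ R R setT c) (@measurable_id _ R setT).
have := @ge0_integral_pushforward _ _ _ _ R _ ms leb setT f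
  measurableT mf (fun y _ => f0 y).
rewrite preimage_setT => <-; apply/esym/eq_measure_integral => A mA _.
have := @lebesgue_measure_unique R
  (pushforward (leb : set mR -> \bar R) (fun x : mR => (c - x)%R : mR)).
apply => // _ [[a b] _ <-] /=.
rewrite /pushforward.
have -> : ((fun x : R => (c - x)%R) @^-1` `]a, b] = `[(c - b)%R, (c - a)%R[)%classic.
  apply/seteqP; split => x /=; rewrite !in_itv/= => /andP[h1 h2]; apply/andP; lra.
rewrite !lebesgue_measure_itv/= !lte_fin ltrD2l ltrN2.
by case: ifP => // _; rewrite -!EFinB; congr EFin; ring.
Qed.

Variables (c s : R).
Hypothesis s0 : s != 0.
Let nu : probability mR R := normal_prob c s.

Let nuE (D : set mR) : measurable D -> nu D = (\int[leb]_(x in D) (normal_pdf c s x)%:E)%E.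
Proof. by []. Qed.

Let integral_nu (F : mR -> \bar R) : (forall x, 0 <= F x)%E -> measurable_fun setT F ->
  (\int[nu]_x F x = \int[leb]_x (F x * (normal_pdf c s x)%:E))%E.
Proof.
move=> F0 mF.
by rewrite (@ge0_integral_density _ mR R leb nu _ (measurable_normal_pdf c s)
  (normal_pdf_ge0 c s) nuE).
Qed.

Let s2 : 0 < s ^+ 2. Proof. by rewrite exprn_even_gt0. Qed.

Lemma measurable_sqr_centered (x0 : R) : measurable_fun setT (fun x : R => (x - x0) ^+ 2).
Proof. by apply: measurable_funX; apply: measurable_funB => //; exact: measurable_id. Qed.

(** The exponent is half of the Gaussian one, so half of the decay remains: the product is
    proportional to a normal density of variance 2 s^2. *)
Lemma normal_exp_sqr_lty :
  (\int[normal_prob c s]_x (expR ((x - c) ^+ 2 / (4 * s ^+ 2)))%:E < +oo)%E.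
Proof.
have me : measurable_fun setT (fun x : mR => expR ((x - c) ^+ 2 / (4 * s ^+ 2))).
  apply: measurableT_comp => //; apply: measurable_funM => //.
  exact: measurable_sqr_centered.
rewrite integral_nu; last 2 first.
- by move=> x; rewrite lee_fin expR_ge0.
- exact/measurable_EFinP.
pose s' := Num.sqrt 2 * s.
have s'0 : s' != 0 by rewrite mulf_neq0// gt_eqF// sqrtr_gt0.
have pk' := normal_peak_gt0 s'0.
rewrite (eq_integral (fun x : mR => (normal_peak s / normal_peak s')%:E *
    (normal_pdf c s' x)%:E)%E); last first.
  move=> x _; rewrite -!EFinM; congr EFin.
  rewrite !normal_pdfE// [RHS]mulrA divfK ?gt_eqF// mulrCA; congr (_ * _).
  rewrite /normal_fun -expRD; congr expR.
  rewrite /s' exprMn sqr_sqrtr// -[s ^+ 2 *+ 2]mulr_natl -[2 * s ^+ 2 *+ 2]mulr_natl.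
  by field.
rewrite ge0_integralZl//.
- by rewrite integral_normal_pdf mule1 ltry.
- by apply/measurable_EFinP; exact: measurable_normal_pdf.
- by move=> x _; rewrite lee_fin normal_pdf_ge0.
- by rewrite lee_fin divr_ge0// normal_peak_ge0.
Qed.

Lemma normal_square_integrable : square_integrable nu (fun x => x - c).
Proof.
apply: square_integrable_ltyP.
  by apply: measurable_funB => //; exact: measurable_id.
have s4 : 0 < 4 * s ^+ 2 by rewrite mulr_gt0.
have me : measurable_fun setT (fun x : mR => expR ((x - c) ^+ 2 / (4 * s ^+ 2))).
  apply: measurableT_comp => //; apply: measurable_funM => //.
  exact: measurable_sqr_centered.
apply: (@le_lt_trans _ _ (\int[nu]_x ((4 * s ^+ 2)%:E *
   (expR ((x - c) ^+ 2 / (4 * s ^+ 2)))%:E))%E).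
  apply: ge0_le_integral => //.
  - by move=> x _; rewrite lee_fin sqr_ge0.
  - by apply/measurable_EFinP; exact: measurable_sqr_centered.
  - by apply/measurable_EFinP; apply: measurable_funM.
  - move=> x _; rewrite -EFinM lee_fin.
    rewrite -ler_pdivrMl ?s4// mulrC (le_trans _ (expR_ge1Dx _))//.
    by rewrite lerDr.
rewrite ge0_integralZl//; [|exact/measurable_EFinP|by rewrite lee_fin ltW].
by apply: lte_mul_pinfty; [rewrite lee_fin ltW| |exact: normal_exp_sqr_lty].
Qed.

(** The law is invariant under x -> 2 c - x, which negates x - c; the mean equals its own
    opposite. *)
Lemma normal_mean : has_mean nu (fun x => x - c) 0.
Proof.
have h := has_mean_integrable (square_integrableW normal_square_integrable).
set a := fine _ in h; suff -> : 0 = a by [].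
have mphi : measurable_fun setT (fun x : mR => (2 * c - x) : mR).
  by have := measurable_funB (@measurable_cst _ _ R R setT (2 * c)) (@measurable_id _ R setT).
have inv A : measurable A -> nu ((fun x : mR => (2 * c - x) : mR) @^-1` A) = nu A.
  move=> mA.
  have mA' : measurable ((fun x : mR => (2 * c - x) : mR) @^-1` A).
    by rewrite -[X in measurable X]setTI; exact: mphi.
  rewrite /= (normal_prob_indic c s mA') (normal_prob_indic c s mA).
  rewrite -[RHS](ge0_integral_lebesgue_reflect (2 * c)).
  - apply: eq_integral => x _; congr EFin.
    rewrite !normal_pdfE// /normal_fun.
    have -> : (2 * c - x - c) ^+ 2 = (x - c) ^+ 2 by ring.
    congr (_ * _); rewrite !indicE; congr (_%:R).
  - by move=> x; rewrite lee_fin mulr_ge0// normal_pdf_ge0.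
  - apply/measurable_EFinP; apply: measurable_funM.
      exact: (@measurable_indic _ mR R setT _ mA).
    exact: measurable_normal_pdf.
have h1 := has_mean_pushforward mphi inv h.
have h2 := has_meanZ (-1) h.
have : a = -1 * a.
  apply: has_mean_uniq h1 _; move: h2; congr has_mean.
  by apply/funext => x /=; ring.
lra.
Qed.

End NormalMoments.

Section GaussianMoments.
Context (R : realType) (n : nat) (m : 'rV[R]_n) (S : 'M[R]_n).
Variable P : probability (n.-tuple R) R.
Hypothesis gP : is_gaussian P m S.
Variable i : 'I_n.
Hypothesis Sii : 0 < S i i.
Local Notation mR := (measurableTypeR R).
Let s := Num.sqrt (S i i).

Let s0 : s != 0. Proof. by rewrite gt_eqF// sqrtr_gt0. Qed.

Lemma gaussian_coord (B : set R) : measurable B ->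
  P ((fun z => tnth z i) @^-1` B) = normal_prob (m 0 i) s B.
Proof.
move=> mB; have := gP (delta_mx 0 i) mB.
have lE z : lin_form (delta_mx 0 i) z = tnth z i.
  rewrite /lin_form (bigD1 i)//= big1 ?addr0; first by rewrite mxE !eqxx mul1r.
  by move=> j ji; rewrite mxE (negbTE ji) andbF mul0r.
have mE : \sum_(j < n) (delta_mx 0 i : 'rV[R]_n) 0 j * m 0 j = m 0 i.
  exact: dotr_delta.
rewrite mE quad_form_delta gt_eqF//.
by have -> : lin_form (delta_mx 0 i) = (fun z : n.-tuple R => tnth z i) by apply/funext.
Qed.

Let mcoord : measurable_fun setT (fun z : n.-tuple R => tnth z i : mR).
Proof. exact: (measurable_tnth (T := R) i). Qed.

Lemma gaussian_square_integrable : square_integrable P (fun z => tnth z i - m 0 i).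
Proof.
have [mf fi] := normal_square_integrable (m 0 i) s0; split.
  by apply: measurable_funB => //; exact: measurable_tnth.
have h := has_mean_integrable fi.
have mono A : measurable A ->
    P ((fun z : n.-tuple R => tnth z i : mR) @^-1` A) = normal_prob (m 0 i) s A.
  by move=> mA; exact: gaussian_coord.
by have [] := has_mean_pushforward mcoord mono h.
Qed.

(* Gibbs' inequality applied to truncations of [(z_i - m_i)^2 / (4 sigma_ii)],
   whose exponential is [P]-integrable. *)
Lemma KL_square_integrable (mu : probability (n.-tuple R) R) : (KL mu P < +oo)%E ->
  square_integrable mu (fun z => tnth z i - m 0 i).
Proof.
move=> KLoo.
have mz : measurable_fun setT (fun z : n.-tuple R => tnth z i - m 0 i).
  by apply: measurable_funB => //; exact: measurable_tnth.
pose h (z : n.-tuple R) := (tnth z i - m 0 i) ^+ 2 / (4 * s ^+ 2).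
have h0 z : 0 <= h z by rewrite /h divr_ge0 ?sqr_ge0// mulr_ge0// sqr_ge0.
have mh : measurable_fun setT h by apply: measurable_funM => //; exact: measurable_funX.
have meh : measurable_fun setT (fun z => (expR (h z))%:E).
  by apply/measurable_EFinP; exact: measurableT_comp.
have eh_lty : (\int[P]_z (expR (h z))%:E < +oo)%E.
  have me : measurable_fun setT (fun x : mR => (expR ((x - m 0 i) ^+ 2 / (4 * s ^+ 2)))%:E).
    apply/measurable_EFinP; apply: measurableT_comp => //; apply: measurable_funM => //.
    exact: measurable_sqr_centered.
  have := @ge0_integral_pushforward _ _ _ _ R _ mcoord P setT _ measurableT me.
  rewrite preimage_setT => <-; last by move=> y _; rewrite lee_fin expR_ge0.
  rewrite (eq_measure_integral (normal_prob (m 0 i) s)); last first.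
    by move=> A mA _; exact: gaussian_coord.
  exact: normal_exp_sqr_lty.
have [C CE] : exists C : R, (\int[P]_z (expR (h z))%:E = C%:E)%E.
  exists (fine (\int[P]_z (expR (h z))%:E)); rewrite fineK// ge0_fin_numE//.
  by apply: integral_ge0 => z _; rewrite lee_fin expR_ge0.
have C1 : 1 <= C.
  rewrite -lee_fin -CE; have [_ <-] := has_mean_cst P 1.
  apply: ge0_le_integral => //.
  by move=> z _; rewrite lee_fin; have := expR_ge1Dx (h z); have := h0 z; lra.
have C0 : 0 < C by lra.
(* Truncation makes the test function bounded, hence [mu]-integrable as Gibbs' inequality requires.
   Subtracting ln C brings its exponential moment below 1. The resulting bound KL + ln C does not
   depend on M, so monotone convergence applies. *)
pose hM (M : nat) z := Num.min (h z) M%:R.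
have mhM M : measurable_fun setT (hM M) by apply: measurable_minr.
have hM0 M z : 0 <= hM M z by rewrite /hM le_min h0 ler0n.
have bound M : (\int[mu]_z (hM M z)%:E <= KL mu P + (ln C)%:E)%E.
  have hb : bounded_mfun (hM M).
    by split => //; exists M%:R => z; rewrite ger0_norm// /hM ge_min lexx orbT.
  have h1 := has_mean_integrable (bounded_mfun_integrable mu hb).
  have h2 := has_meanD h1 (has_mean_cst mu (- ln C)).
  have m2 : measurable_fun setT (fun z => hM M z + - ln C) by exact: measurable_funD.
  have e2 : (\int[P]_z (expR (hM M z + - ln C))%:E <= 1)%E.
    apply: (@le_trans _ _ (\int[P]_z (C^-1%:E * (expR (h z))%:E))%E).
      apply: ge0_le_integral => //.
      + by apply/measurable_EFinP; exact: measurableT_comp.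
      + by apply: emeasurable_funM.
      + move=> z _; rewrite -EFinM lee_fin expRD expRN lnK// mulrC.
        by rewrite ler_pM2l ?invr_gt0// ler_expR /hM ge_min lexx.
    rewrite ge0_integralZl//; last first.
    + by rewrite lee_fin invr_ge0 ltW.
    by rewrite CE -EFinM mulVf// gt_eqF.
  have := gibbs m2 e2 h2.1; rewrite h2.2 h1.2 => G.
  apply: le_trans (leeD2r (ln C)%:E G).
  by rewrite -EFinD lee_fin subrK.
have hlty : (\int[mu]_z (h z)%:E < +oo)%E.
  apply: (@le_lt_trans _ _ (KL mu P + (ln C)%:E)%E); last first.
    by rewrite lte_add_pinfty// ltry.
  have := @cvg_monotone_convergence _ _ R mu setT measurableT (fun M z => (hM M z)%:E).
  have lE z : limn (fun M => (hM M z)%:E) = (h z)%:E.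
    apply/cvg_lim => //; apply: cvg_near_cst; near=> M.
    congr EFin; apply/min_idPl.
    by near: M; exact: nbhs_infty_ger.
  under [in X in _ -> _ -> _ -> X]eq_integral do rewrite lE.
  move=> cv; have {}cv : (\int[mu]_z (hM M z)%:E @[M --> \oo] --> \int[mu]_z (h z)%:E)%E.
    apply: cv => //.
    - by move=> M; exact/measurable_EFinP.
    - by move=> M z _; rewrite lee_fin.
    - move=> z _ M M' MM'; rewrite lee_fin /hM le_min ge_min lexx/= ge_min ler_nat MM' orbT//.
  rewrite -(cvg_lim _ cv)//; apply: lime_le; first by apply/cvg_ex; eexists; exact: cv.
  by near=> M; exact: bound.
apply: square_integrable_ltyP => //.
have s2 : 0 < 4 * s ^+ 2 by rewrite mulr_gt0// exprn_even_gt0.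
rewrite (eq_integral (fun z => (4 * s ^+ 2)%:E * (h z)%:E)%E); last first.
  by move=> z _; rewrite -EFinM /h mulrC divfK// gt_eqF.
rewrite ge0_integralZl//.
- by rewrite lte_mul_pinfty// lee_fin ltW.
- exact/measurable_EFinP.
- by move=> z _; rewrite lee_fin.
- by rewrite lee_fin ltW.
Unshelve. all: by end_near. Qed.

End GaussianMoments.

(** * The information projection *)

Lemma probability_of_measure d (T : measurableType d) (R : realType)
    (m : {measure set T -> \bar R}) : m setT = 1%E ->
  exists P : probability T R, forall A, P A = m A.
Proof.
case: m => nu c /= nu1.
pose m' : measure T R := Measure.Pack c.
pose b := Measure_isProbability.Build _ _ _ m' nu1.
pose P : probability T R := HB.pack nu m' b.
by exists P.
Qed.

(** * The mean of the log-ratio under a law with the star structure *)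

Section StarMean.
Context (R : realType) (k : nat) (m : 'rV[R]_k.+1) (S : 'M[R]_k.+1).
Hypothesis pS : posdef S.
Local Notation mR := (measurableTypeR R).
Local Notation Q := (invmx S).

Definition block_form (w : 'I_k -> R) : R :=
  \sum_i \sum_j Q (lift ord0 i) (lift ord0 j) * (w i * w j).

(** Extend w by a zero head: the residuals of the extension are w itself, so the block form is a
    value of the positive definite form of Q. *)
Lemma block_form_gt0 (w : 'I_k -> R) j : w j != 0 -> 0 < block_form w.
Proof.
move=> wj; pose v : 'rV[R]_k.+1 := \row_i (if unlift ord0 i is Some l then w l else 0).
have v0 : v 0 ord0 = 0 by rewrite mxE unlift_none.
have vS l : residual S v l = w l by rewrite /residual v0 mulr0 subr0 mxE liftK.
have := quad_form_invmx_residual pS v.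
rewrite v0 expr0n mul0r add0r.
under eq_bigr do under eq_bigr do rewrite !vS.
rewrite -/(block_form w) => <-; apply: quad_form_invmx_gt0 => //.
apply: contraNneq wj => v00.
by have := vS j; rewrite v00 /residual !mxE mulr0 subr0 => <-.
Qed.

Lemma block_form_ge0 (w : 'I_k -> R) : 0 <= block_form w.
Proof.
have [/existsP[j wj]|/existsPn w0] := boolP [exists j, w j != 0].
  exact/ltW/(block_form_gt0 wj).
rewrite /block_form big1// => i _; rewrite big1// => j _.
by have := w0 i; rewrite negbK => /eqP ->; rewrite mul0r mulr0.
Qed.

(* Log-density of [star_density u] with respect to [N(m, S)], up to the constant [K0]. *)
Definition log_ratio (K0 : R) (u : 'I_k -> R -> R) (z : k.+1.-tuple R) : R :=
  K0 + (block_form (residual S (centered m z)) -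
    \sum_j Q (lift ord0 j) (lift ord0 j) *
      (residual S (centered m z) j - u j (tnth z ord0)) ^+ 2) / 2.

Lemma measurable_log_ratio K0 u : (forall j, measurable_fun setT (u j)) ->
  measurable_fun setT (log_ratio K0 u).
Proof.
move=> mu; have mr := measurable_residual m S.
apply: measurable_funD => //; apply: measurable_funM => //; apply: measurable_funB.
  apply: measurable_sum => i; apply: measurable_sum => j.
  by apply: measurable_funM => //; exact: measurable_funM.
apply: measurable_sum => j; apply: measurable_funM => //; apply: measurable_funX.
apply: measurable_funB => //.
exact: (measurableT_comp (mu j) (measurable_tnth (T := R) ord0)).
Qed.

Section Mean.
Variables (mu : probability (k.+1.-tuple R) R) (mu1 : probability mR R).
Variable K : 'I_k -> R.-pker mR ~> mR.
Hypothesis muE : forall A : 'I_k.+1 -> set R, (forall i, measurable (A i)) ->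
  mu (rect_set A) = star_prod mu1 (fun j x => K j x) A.
Hypothesis sq : forall i, square_integrable mu (fun z => tnth z i - m 0 i).

(** The shift u_j of the overview. [fine] returns 0 where the conditional mean is infinite; this is
    confined to heads whose conditional second moment is infinite, a [mu1]-null set. *)
Definition cond_shift (j : 'I_k) (x : R) : R :=
  fine (\int[K j x]_y (y - mstar m S j x)%:E)%E.

Let mres j : measurable_fun setT (fun p : mR * mR => p.2 - mstar m S j p.1).
Proof.
have m2 : measurable_fun setT (fun p : mR * mR => p.2 : R).
  by have := @measurable_snd _ _ mR mR; exact.
apply: measurable_funB => //.
exact: (measurableT_comp (measurable_mstar m S j) (@measurable_fst _ _ mR mR)).
Qed.

Lemma measurable_cond_shift j : measurable_fun setT (cond_shift j).
Proof.
pose F (p : mR * mR) : \bar R := (p.2 - mstar m S j p.1)%:E.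
have mF : measurable_fun setT F by apply/measurable_EFinP; exact: mres.
have mp : measurable_fun setT (fun x : mR => \int[K j x]_y F^\+ (x, y))%E.
  apply: (measurable_fun_integral_sfinite_kernel (F^\+)%E (K j)) => //.
  exact: measurable_funepos.
have mn : measurable_fun setT (fun x : mR => \int[K j x]_y F^\- (x, y))%E.
  apply: (measurable_fun_integral_sfinite_kernel (F^\-)%E (K j)) => //.
  exact: measurable_funeneg.
have -> : cond_shift j = fine \o
    (fun x : mR => \int[K j x]_y F^\+ (x, y) - \int[K j x]_y F^\- (x, y))%E.
  apply/funext => x; rewrite /cond_shift /=; congr fine.
  rewrite integralE; congr (_ - _)%E;
    by apply: eq_integral => y _; rewrite ?funeposE ?funenegE.
apply: (measurableT_comp (fine_measurable measurableT)).
exact: emeasurable_funB.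
Qed.

Let resE z j : residual S (centered m z) j =
  (tnth z (lift ord0 j) - m 0 (lift ord0 j)) + - cond_slope S j * (tnth z ord0 - m 0 ord0).
Proof. by rewrite /residual !mxE; ring. Qed.

Let sq_res j : square_integrable mu (fun z => residual S (centered m z) j).
Proof.
under eq_fun do rewrite resE.
by apply: square_integrableD => //; exact: square_integrableZ.
Qed.

Let ge0_integral_coord (c : R) j x :
  (\int[cond_law K x]_t ((tnth t j - c) ^+ 2)%:E = \int[K j x]_y ((y - c) ^+ 2)%:E)%E.
Proof.
pose f l (y : mR) : \bar R := (if l == j then (y - c) ^+ 2 else 1)%:E.
transitivity (\int[cond_law K x]_t \prod_l f l (tnth t l))%E.
  apply: eq_integral => t _; rewrite (bigD1 j)//= big1 ?mule1 /f ?eqxx//.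
  by move=> l lj; rewrite (negbTE lj).
rewrite [LHS](@integral_prodk_prod R _ mR k (fun j => K j : R.-sfker mR ~> mR) x f).
- rewrite (bigD1 j)//= big1 ?mule1.
    by rewrite /f eqxx.
  move=> l lj; rewrite /f (negbTE lj) integral_cst// mul1e; exact: prob_kernel.
- by move=> l y; rewrite /f lee_fin; case: ifP => // _; rewrite sqr_ge0.
- move=> l; apply/measurable_EFinP; case: (l == j) => //.
  exact: measurable_sqr_centered.
Qed.

Let resS x (t : k.-tuple R) j :
  residual S (centered m [the k.+1.-tuple R of x :: t]) j = tnth t j - mstar m S j x.
Proof. by rewrite residual_mstar tnthS. Qed.

Let second_moment j :
  (\int[mu1]_x \int[K j x]_y ((y - mstar m S j x) ^+ 2)%:E < +oo)%E.
Proof.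
have [mr /integrableP[_]] := sq_res j.
under eq_integral do rewrite gee0_abs ?lee_fin ?sqr_ge0//.
rewrite (ge0_integral_star muE (F := fun z => (residual S (centered m z) j ^+ 2)%:E)).
- congr (_ < _)%E; apply: eq_integral => x _.
  rewrite -ge0_integral_coord; apply: eq_integral => t _.
  by rewrite resS.
- by move=> z; rewrite lee_fin sqr_ge0.
- by apply/measurable_EFinP; exact: measurable_funX.
Qed.

Let measurable_second_moment j :
  measurable_fun setT (fun x : mR => \int[K j x]_y ((y - mstar m S j x) ^+ 2)%:E)%E.
Proof.
apply: (measurable_fun_integral_sfinite_kernel
  (fun p : mR * mR => ((p.2 - mstar m S j p.1) ^+ 2)%:E) (K j)).
- by move=> p; rewrite lee_fin sqr_ge0.
- by apply/measurable_EFinP; apply: measurable_funX; exact: mres.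
Qed.

Let kernel_probability x : exists P_ : 'I_k -> probability mR R,
  forall j A, P_ j A = K j x A.
Proof.
have h j : exists P : probability mR R, forall A, P A = K j x A.
  exact/probability_of_measure/prob_kernel.
by have [P_ PK] := choice h; exists P_.
Qed.

Let int_kernel (j : 'I_k) (x : mR) (P : probability mR R) (F : mR -> \bar R) :
  (forall A, P A = K j x A) -> (\int[P]_y F y = \int[K j x]_y F y)%E.
Proof. by move=> PK; apply: eq_measure_integral => A _ _; exact: PK. Qed.

Let sqr_cond_shift_le j x :
  ((cond_shift j x ^+ 2)%:E <= \int[K j x]_y ((y - mstar m S j x) ^+ 2)%:E)%E.
Proof.
have [P_ P_K] := kernel_probability x.
rewrite /cond_shift -!(int_kernel _ (P_K j)).
apply: sqr_mean_le.
by apply: measurable_funB => //; exact: measurable_id.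
Qed.

(** Jensen's inequality in each kernel bounds the squared shift by the conditional second moment,
    whose [mu1]-integral is finite. *)
Let sq_shift j : square_integrable mu1 (cond_shift j).
Proof.
have ms := measurable_cond_shift j.
apply: square_integrable_ltyP => //.
apply: le_lt_trans (second_moment j); apply: ge0_le_integral => //.
- by move=> x _; rewrite lee_fin sqr_ge0.
- by apply/measurable_EFinP; exact: measurable_funX.
Qed.

Let mhead : measurable_fun setT (fun z : k.+1.-tuple R => tnth z ord0 : mR).
Proof. exact: (measurable_tnth (T := R) ord0). Qed.

Lemma star_marginal (A : set mR) : measurable A ->
  mu ((fun z : k.+1.-tuple R => tnth z ord0 : mR) @^-1` A) = mu1 A.
Proof.
move=> mA; pose B (i : 'I_k.+1) : set R := if i == ord0 then A else setT.
have mB i : measurable (B i) by rewrite /B; case: eqP.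
have e : (fun z : k.+1.-tuple R => tnth z ord0 : mR) @^-1` A = rect_set B.
  apply/seteqP; split => z /=; first by move=> zA i; rewrite /B; case: eqP => [->|].
  by move=> /(_ ord0); rewrite /B eqxx.
rewrite e muE// /star_prod {1}/B eqxx.
under eq_integral => x _.
  rewrite big1; last by move=> j _; rewrite /B/= prob_kernel.
  over.
by rewrite /= integral_cst// mul1e.
Qed.

Let sq_shift_head j : square_integrable mu (fun z => cond_shift j (tnth z ord0)).
Proof.
split; first exact: (measurableT_comp (measurable_cond_shift j) mhead).
have h := has_mean_integrable (sq_shift j).2.
by have [] := has_mean_pushforward mhead star_marginal h.
Qed.

Lemma integrable_log_ratio K0 : mu.-integrable setT (EFin \o log_ratio K0 cond_shift).
Proof.
have h1 i j := has_meanZ (Q (lift ord0 i) (lift ord0 j))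
  (has_mean_integrable (square_integrableM (sq_res i) (sq_res j))).
have sqd j : square_integrable mu
    (fun z => residual S (centered m z) j + -1 * cond_shift j (tnth z ord0)).
  by apply: square_integrableD => //; exact: square_integrableZ.
have h2 j := has_meanZ (Q (lift ord0 j) (lift ord0 j)) (has_mean_integrable (sqd j).2).
have [] := has_meanD (has_mean_cst mu K0) (has_meanZ 2^-1 (has_meanD
  (has_mean_sum (index_enum 'I_k) (fun i => has_mean_sum (index_enum 'I_k) (h1 i)))
  (has_meanZ (-1) (has_mean_sum (index_enum 'I_k) h2)))).
move=> + _; congr (integrable _ _ _); apply/funext => z /=; congr EFin.
rewrite /log_ratio /block_form mulN1r [2^-1 * _]mulrC; congr (_ + (_ - _) / 2).
by apply: eq_bigr => j _; rewrite mulN1r.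
Qed.

Lemma star_mean K0 : exists e, has_mean mu1 (fun x => block_form (cond_shift ^~ x)) e /\
  (\int[mu]_z (log_ratio K0 cond_shift z)%:E = (K0 + e / 2)%:E)%E.
Proof.
have hu i j := has_meanZ (Q (lift ord0 i) (lift ord0 j))
  (has_mean_integrable (square_integrableM (sq_shift i) (sq_shift j))).
have hb := has_mean_sum (index_enum 'I_k) (fun i => has_mean_sum (index_enum 'I_k) (hu i)).
set e := (X in has_mean _ _ X) in hb; exists e; split; first exact: hb.
have ht := has_meanD (has_mean_cst mu1 K0) (has_meanZ 2^-1 hb).
rewrite (mulrC 2^-1) in ht; rewrite -ht.2.
have [mF ->] := integral_star muE (integrable_log_ratio K0).
apply: ae_eq_integral => //.
  by have /measurable_int := ht.1.
(* The quadratic mean can be computed only at heads where all conditional second moments are finite;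
   these have full [mu1]-measure. *)
have fin j : {ae mu1, forall x : mR,
    (\int[K j x]_y ((y - mstar m S j x) ^+ 2)%:E < +oo)%E}.
  have ii : mu1.-integrable setT (fun x : mR => \int[K j x]_y ((y - mstar m S j x) ^+ 2)%:E)%E.
    apply/integrableP; split => //.
    under eq_integral => x _.
      rewrite gee0_abs; last by apply: integral_ge0 => y _; rewrite lee_fin sqr_ge0.
      over.
    exact: second_moment.
  apply: filterS (integrable_ae measurableT ii) => x /(_ I).
  by rewrite ltey => /fin_numP[].
have fin_all : {ae mu1, forall x : mR, forall j : 'I_k,
    (\int[K j x]_y ((y - mstar m S j x) ^+ 2)%:E < +oo)%E}.
  by apply: filter_forall => j; exact: fin.
apply: filterS fin_all => x finx _.
have [P_ P_K] := kernel_probability x.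
have [P PK] := probability_of_measure (cond_lawT K x).
have PE (A : 'I_k -> set R) : (forall i, measurable (A i)) ->
    P (rect_set A) = (\prod_j P_ j (A j))%E.
  by move=> mA; rewrite PK cond_law_rect//; apply: eq_bigr => j _; rewrite P_K.
have sqP j : square_integrable (P_ j) (fun y => y - mstar m S j x).
  apply: square_integrable_ltyP.
    by apply: measurable_funB => //; exact: measurable_id.
  by rewrite (int_kernel _ (P_K j)).
have uE j : cond_shift j x = fine (\int[P_ j]_y (y - mstar m S j x)%:E)%E.
  by rewrite /cond_shift (int_kernel _ (P_K j)).
have [_ h] := has_mean_quadratic PE (fun i j => Q (lift ord0 i) (lift ord0 j)) K0 sqP uE.
transitivity (\int[P]_t (log_ratio K0 cond_shift [the k.+1.-tuple R of x :: t])%:E)%E.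
  by apply/esym/eq_measure_integral => A _ _; exact: PK.
rewrite [RHS](_ : _ = (K0 + block_form (cond_shift ^~ x) / 2)%:E); last first.
  by congr EFin; congr (_ + _); rewrite mulrC.
rewrite -h; apply: eq_integral => t _; congr EFin.
rewrite /log_ratio /block_form; congr (_ + (_ - _) / 2).
  by apply: eq_bigr => i _; apply: eq_bigr => j _; rewrite !resS.
by apply: eq_bigr => j _; rewrite resS.
Qed.

End Mean.
End StarMean.

(** * Lower bound, attainment and uniqueness *)

Section StarProjection.
Context (R : realType) (k : nat) (m : 'rV[R]_k.+1) (S : 'M[R]_k.+1).
Hypothesis pS : posdef S.
Local Notation mR := (measurableTypeR R).
Local Notation Q := (invmx S).
Variable pi : probability (k.+1.-tuple R) R.
Hypothesis gpi : is_gaussian pi m S.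

Let zero_shift (j : 'I_k) (x : R) : R := 0.

Let mzero j : measurable_fun setT (zero_shift j).
Proof. exact: measurable_cst. Qed.

(** Both densities contain the same head term v_0^2 / S_00, which cancels. K0 is the log-ratio of
    the normalising constants and precedes [u] in the statement because shifting the conditional
    means does not change them. *)
Lemma log_ratio_density : exists K0, forall u, (forall j, measurable_fun setT (u j)) ->
  forall A, measurable A ->
  (\int[pi]_(z in A) (expR (log_ratio m S K0 u z))%:E =
   \int[lebn R k.+1]_(z in A) (star_density m S u z)%:E)%E.
Proof.
have [c c0 piE] := gaussian_density pS gpi.
have sc0 := star_const_gt0 pS.
exists (ln (star_const S / c)) => u mu A mA.
have md : measurable_fun setT (fun z => c * expR (- (quad_form (centered m z) Q / 2))).
  apply: measurable_funM => //; apply: measurableT_comp => //.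
  apply: measurable_funN; apply: measurable_funM => //.
  exact: measurable_quad_form_centered.
have d0 z : 0 <= c * expR (- (quad_form (centered m z) Q / 2)).
  by rewrite mulr_ge0 ?expR_ge0// ltW.
rewrite [LHS]integral_mkcond [RHS]integral_mkcond.
rewrite (ge0_integral_density md d0 piE).
- apply: eq_integral => z _; rewrite !patchE; case: ifP => _; last by rewrite mul0e.
  rewrite -EFinM; congr EFin.
  rewrite star_densityE// /log_ratio expRD lnK ?posrE ?divr_gt0//.
  rewrite (quad_form_invmx_residual pS) -/(block_form S (residual S (centered m z))).
  have -> a e b : a / c * e * (c * b) = a * (e * b) by field; rewrite gt_eqF.
  rewrite -expRD; congr (_ * expR _).
  by field; rewrite gt_eqF// posdef_diag_gt0.
- by move=> z; apply: erestrict_ge0 => y _; rewrite lee_fin expR_ge0.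
- apply/(measurable_restrictT _ _).1 => //; apply: measurable_funTS.
  apply/measurable_EFinP; apply: measurableT_comp => //.
  exact: measurable_log_ratio.
Qed.

Theorem star_projection : exists pistar : probability (k.+1.-tuple R) R,
  [/\ (forall A : 'I_k.+1 -> set R, (forall i, measurable (A i)) ->
         pistar (rect_set A) =
         star_prod (normal_prob (m 0 ord0) (Num.sqrt (S ord0 ord0)))
           (fun j z1 => normal_prob (mstar m S j z1)
               (Num.sqrt ((invmx S (lift ord0 j) (lift ord0 j))^-1)))
           A),
      is_gaussian pistar m (Sigma_star S),
      C_star pistar,
      (forall mu, C_star mu -> (KL pistar pi <= KL mu pi)%E) &
      (forall mu, C_star mu -> KL mu pi = KL pistar pi ->
         forall A, measurable A -> mu A = pistar A)].
Proof.
have [pistar pistarE] := density_probability (measurable_star_density m pS mzero)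
  (star_density_ge0 m S zero_shift) (integral_star_density m pS mzero).
have rectE (A : 'I_k.+1 -> set R) : (forall i, measurable (A i)) ->
    pistar (rect_set A) = star_prod (normal_prob (m 0 ord0) (marg_sd S))
      (fun j x => star_ker m pS mzero j x) A.
  by move=> mA; rewrite pistarE integral_star_density_rect.
have gstar : is_gaussian pistar m (Sigma_star S).
  apply: (density_is_gaussian (q := star_energy S) (c := star_const S)).
  - exact/ltW/star_const_gt0.
  - apply: measurable_funM => //; apply: measurable_funD.
      by apply: measurable_funM => //; apply: measurable_funX; exact: measurable_centered.
    apply: measurable_sum => j; apply: measurable_funM => //.
    by apply: measurable_funX; exact: measurable_residual.
  - move=> A _; rewrite pistarE; apply: eq_integral => z _; congr EFin.
    rewrite star_densityE//; congr (_ * expR (- (_ / 2))); congr (_ + _).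
    by apply: eq_bigr => j _; rewrite subr0.
  - by move=> a v t; exact: star_energy_shift.
  - by move=> a; exact: quad_form_Sigma_star_gt0.
have [K0 ratioE] := log_ratio_density.
have sqstar i : square_integrable pistar (fun z => tnth z i - m 0 i).
  apply: (gaussian_square_integrable gstar).
  by rewrite -quad_form_delta; apply: quad_form_Sigma_star_gt0 => //; exact: delta_mx_neq0.
have shift0 j x : cond_shift m S (star_ker m pS mzero) j x = 0.
  rewrite /cond_shift.
  have -> : (\int[star_ker m pS mzero j x]_y (y - mstar m S j x)%:E = 0)%E.
    have [_ h] := normal_mean (mstar m S j x + zero_shift j x) (star_sd_neq0 pS j).
    by rewrite -[RHS]h; apply: eq_integral => y _; rewrite /zero_shift addr0.
  by [].
(* The conditional shifts of [pistar] vanish, so its log-ratio is the one of its own density and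
   [star_mean] gives K0 with e = 0. *)
have KLstar : KL pistar pi = K0%:E.
  rewrite (@KL_density _ _ _ _ (log_ratio m S K0 zero_shift)); first last.
  - by move=> A mA; rewrite pistarE ratioE.
  - exact: measurable_log_ratio.
  have [e [he]] := star_mean S rectE sqstar K0.
  have -> : e = 0.
    apply: has_mean_uniq he _.
    have -> : (fun x : mR => block_form S ((cond_shift m S (star_ker m pS mzero))^~ x)) = fun=> 0.
      apply/funext => x; rewrite /block_form big1// => i _; rewrite big1// => j _.
      by rewrite !shift0 mul0r mulr0.
    exact: has_mean_cst.
  rewrite mul0r addr0 => <-; apply: eq_integral => z _; congr EFin.
  rewrite /log_ratio; congr (_ + (_ - _) / 2).
  by apply: eq_bigr => j _; rewrite shift0.
(* Finite KL supplies the second moments that [star_mean] needs. The last component keeps the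
   equality case of Gibbs' inequality for uniqueness. *)
have lower mu : C_star mu -> (KL mu pi < +oo)%E -> exists mu1 : probability mR R,
    exists K : 'I_k -> R.-pker mR ~> mR, exists e,
    [/\ forall A : set mR, measurable A ->
          mu ((fun z : k.+1.-tuple R => tnth z ord0 : mR) @^-1` A) = mu1 A,
        has_mean mu1 (fun x => block_form S (cond_shift m S K ^~ x)) e,
        ((K0 + e / 2)%:E <= KL mu pi)%E &
        KL mu pi = (K0 + e / 2)%:E -> forall A, measurable A ->
          (mu A <= \int[pi]_(z in A) (expR (log_ratio m S K0 (cond_shift m S K) z))%:E)%E].
  move=> [mu1 [K muE]] KLoo.
  have sq i : square_integrable mu (fun z => tnth z i - m 0 i).
    by apply: (KL_square_integrable gpi) => //; exact: posdef_diag_gt0.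
  have [e [he e2]] := star_mean S muE sq K0.
  have mcs := measurable_cond_shift m S K.
  have mlr := measurable_log_ratio m S K0 mcs.
  (* The exponential integrates to the total mass of rho_u, which is 1. *)
  have int1 : (\int[pi]_z (expR (log_ratio m S K0 (cond_shift m S K) z))%:E <= 1)%E.
    by rewrite ratioE// integral_star_density.
  have ilr := integrable_log_ratio S muE sq K0.
  exists mu1, K, e; split => //.
  - exact: (star_marginal muE).
  - by rewrite -e2; exact: gibbs.
  - by rewrite -e2; exact: gibbs_eq.
exists pistar; split.
- move=> A mA; rewrite (rectE A mA) /star_prod.
  apply: eq_integral => x _; congr EFin; apply: eq_bigr => j _; congr fine.
  transitivity (normal_prob (mstar m S j x + zero_shift j x) (star_sd S j)
    (A (lift ord0 j))); first by [].
  by rewrite /zero_shift addr0.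
- exact: gstar.
- exists (normal_prob (m 0 ord0) (marg_sd S)), (star_ker m pS mzero) => A mA.
  exact: rectE.
- move=> mu Cmu; rewrite KLstar.
  have [KLoo|] := boolP (KL mu pi < +oo)%E; last first.
    by rewrite -leNgt leye_eq => /eqP ->; rewrite leey.
  have [mu1 [K [e [_ he le _]]]] := lower mu Cmu KLoo.
  apply: le_trans le; rewrite lee_fin lerDl divr_ge0//.
  by apply: has_mean_ge0 he => x; exact: block_form_ge0.
- move=> mu Cmu; rewrite KLstar => KLmu.
  have KLoo : (KL mu pi < +oo)%E by rewrite KLmu ltry.
  have [mu1 [K [e [marg he le dens]]]] := lower mu Cmu KLoo.
  have bf0 (x : mR) : 0 <= block_form S (cond_shift m S K ^~ x) by exact: block_form_ge0.
  have e0 : e = 0.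
    apply/eqP; rewrite eq_le (has_mean_ge0 bf0 he) andbT.
    by move: le; rewrite KLmu lee_fin; lra.
  have mbf : measurable_fun setT (fun x : mR => (block_form S (cond_shift m S K ^~ x))%:E).
    exact: measurable_int he.1.
  have [+ _] := ae_eq_integral_abs mu1 measurableT mbf.
  under eq_integral do rewrite gee0_abs ?lee_fin//.
  rewrite he.2 e0 => /(_ erefl)[N [mN N0 sN]].
  (* The [mu]-null cylinder over the heads at which the shift may be nonzero. *)
  pose B := (fun z : k.+1.-tuple R => tnth z ord0 : mR) @^-1` N.
  have mB : measurable B.
    rewrite -[X in measurable X]setTI.
    exact: (measurable_tnth (T := R) ord0 measurableT mN).
  have muB : mu B = 0%E by rewrite marg.
  (* Outside [B] the block form of the shift is 0, so the shift vanishes and the bounding density is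
     that of [pistar]; [B] itself costs [mu] nothing. *)
  have le_star A : measurable A -> (mu A <= pistar A)%E.
    move=> mA; apply: (@le_trans _ _ (mu (A `\` B))).
      rewrite -[in leLHS](setUIDK A B) measureU//; first last.
      - by rewrite setDE setIACA setICr setI0.
      - exact: measurableD.
      - exact: measurableI.
      rewrite [X in (X + _)%E](_ : _ = 0%E) ?add0e//.
      apply/eqP; rewrite eq_le measure_ge0 andbT -muB.
      by apply: le_measure; rewrite ?inE//; exact: measurableI.
    apply: (@le_trans _ _ (pistar (A `\` B))); last first.
      by apply: le_measure; rewrite ?inE//; exact: measurableD.
    have mAB : measurable (A `\` B) by exact: measurableD.
    apply: le_trans (dens _ _ mAB) _; first by rewrite KLmu e0 mul0r addr0.
    rewrite pistarE -ratioE// le_eqVlt; apply/orP; left; apply/eqP.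
    apply: eq_integral => z /set_mem[_ nBz]; congr (expR _)%:E.
    have bz : block_form S (cond_shift m S K ^~ (tnth z ord0)) = 0.
      apply: contrapT => bz; apply: nBz; apply: sN => /= h; apply: bz.
      by have [] := h I.
    rewrite /log_ratio; congr (_ + (_ - _) / 2); apply: eq_bigr => j _.
    have [->//|sj] := eqVneq (cond_shift m S K j (tnth z ord0)) 0.
    by have := block_form_gt0 pS (w := cond_shift m S K ^~ (tnth z ord0)) sj; rewrite bz ltxx.
  move=> A mA; apply/eqP; rewrite eq_le le_star//=.
  (* Both total masses being 1, the bound on the complement is the reverse inequality on [A]. *)
  have := le_star _ (measurableC mA).
  by rewrite !probability_setC// leeD2lE// leeN2.
Qed.

End StarProjection.

(* d = n.+2 >= 2; coordinate z_1 is ord0. *)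
Theorem mainTheorem7 (R : realType) (n : nat)
    (m : 'rV[R]_n.+2) (S : 'M[R]_n.+2)
    (pi : probability (n.+2.-tuple R) R) :
  posdef S -> is_gaussian pi m S ->
  exists pistar : probability (n.+2.-tuple R) R,
    [/\ (* pistar(dz) = p*(dz_1) q*(dz_{-1} | z_1) *)
        (forall A : 'I_n.+2 -> set R, (forall i, measurable (A i)) ->
           pistar (rect_set A) =
           star_prod (normal_prob (m 0 ord0) (Num.sqrt (S ord0 ord0)))
             (fun j z1 => normal_prob (mstar m S j z1)
                 (Num.sqrt ((invmx S (lift ord0 j) (lift ord0 j))^-1)))
             A),
        (* equivalently pistar = N(m, Sigma_star) *)
        is_gaussian pistar m (Sigma_star S),
        C_star pistar,
        (forall mu, C_star mu -> (KL pistar pi <= KL mu pi)%E) &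
        (forall mu, C_star mu -> KL mu pi = KL pistar pi ->
           forall A, measurable A -> mu A = pistar A)].
Proof. by move=> pS gpi; exact: (star_projection pS gpi). Qed.
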